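(* Let $n\in\{0,1,2,\dots\}$, let $q\in\mathbb{C}$ with $0<|q|<1$, let $a,b\in\mathbb{C}\setminus\{0\}$, and let $x=\frac12(z+z^{-1})$ with $z\in\mathbb{C}\setminus\{0\}$. Then as $n\to\infty$, $$Q_n(x;a,b|q^{-1})\sim q^{-\binom n2}\,T_n,$$ where $$T_n=\begin{cases}(-b)^n\dfrac{(\frac zb,\frac1{bz};q)_\infty}{(\frac ab;q)_\infty},&\text{if }|a|<|b|,\\[3mm](-a)^n\dfrac{(\frac za,\frac1{az};q)_\infty}{(\frac ba;q)_\infty},&\text{if }|a|>|b|,\\[3mm](-a)^n\dfrac{(\frac za,\frac1{az};q)_\infty}{(\frac ba;q)_\infty}+(-b)^n\dfrac{(\frac zb,\frac1{bz};q)_\infty}{(\frac ab;q)_\infty},&\text{if }|a|=|b|,\ a\ne b,\\[3mm]\bigl(n+1+\lambda(z;a;q)\bigr)(-a)^n\dfrac{(\frac za,\frac1{az};q)_\infty}{(q;q)_\infty},&\text{if }a=b,\end{cases}$$ and in the last formula $$\lambda(z;a;q)=\frac{z\,\mathrm{E}_q'(-\frac za)}{a\,(\frac za;q)_\infty}+\frac{\mathrm{E}_q'(-\frac1{az})}{za\,(\frac1{az};q)_\infty}-\frac{2q\,\mathrm{E}_q'(-q)}{(q;q)_\infty},\qquad \mathrm{E}_q'(t)=\sum_{k=1}^\infty\frac{q^{\binom k2}}{(q;q)_k}\,k\,t^{k-1}.$$ The error term of the asymptotic formula is of order $\mathcal{O}\!\left(\frac{|q|^{-\binom n2}(\max\{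|a|,|b|\})^n}{n}\right)$.
   Context: Notation: $(A;p)_n=\prod_{j=0}^{n-1}(1-Ap^j)$ for $p\in\mathbb{C}\setminus\{0\}$; $(A;q)_\infty=\prod_{j\ge0}(1-Aq^j)$; $(A_1,\dots,A_k;p)_n=\prod_i(A_i;p)_n$ (also $n=\infty$). $\binom n2=\frac{n(n-1)}2$. $\mathrm{E}_q'$ is the derivative of $\mathrm{E}_q(t)=\sum_{k\ge0}\frac{q^{\binom k2}t^k}{(q;q)_k}=(-t;q)_\infty$. Al-Salam--Chihara polynomials: for a base $p\in\mathbb{C}\setminus\{0\}$, $|p|\ne1$, $a\neq0$, $x=\frac12(z+z^{-1})$, $$Q_n(x;a,b|p)=a^{-n}\sum_{k=0}^n\frac{(p^{-n},az,az^{-1};p)_k\,(abp^k;p)_{n-k}}{(p;p)_k}\,p^k,$$ which equals $a^{-n}(ab;p)_n\,{}_3\phi_2(p^{-n},az,az^{-1};ab,0;p,p)$ when the latter is defined, where ${}_3\phi_2(a_1,a_2,a_3;b_1,b_2;p,w)=\sum_{k\ge0}\frac{(a_1,a_2,a_3;p)_k}{(p,b_1,b_2;p)_k}w^k$. The $q^{-1}$-Al-Salam--Chihara polynomials are $Q_n(x;a,b|q^{-1})$, i.e. $p=q^{-1}$.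
   Formalization: The formula with its O-error is proved in all cases, assuming for a=b that (z/a;q)_∞ and (1/(az);q)_∞ are nonzero (λ is undefined otherwise); strict ''~'' is claimed only if the leading product is nonzero (|a|≠|b|), or, for |a|=|b|, a≠b, if the error term is o(main term). *)

(* Defs.v *)
From HB Require Import structures.
From mathcomp Require Import all_boot all_order all_algebra.
From mathcomp Require Import complex.
From mathcomp Require Import all_classical all_reals all_analysis.
From mathcomp Require Import ring.

Set Implicit Arguments.
Unset Strict Implicit.
Unset Printing Implicit Defensive.

Import Order.TTheory GRing.Theory Num.Theory.
Import numFieldNormedType.Exports.

Local Open Scope classical_set_scope.
Local Open Scope ring_scope.

(* R[i] packaged as a numClosedFieldType, so that it gets the norm topology
   which the library puts on every numFieldType.  The norm `|z| is then itself
   an element of the field (a nonnegative real one); on such elements < and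
   Num.max are the usual order and maximum of the reals. *)
Definition Cplx (R : realType) : numClosedFieldType := R[i].

Section AlSalamChihara.
Variable C : numClosedFieldType.
Implicit Types (A p q a b z x t : C) (n k : nat).

Definition qpoch A p n : C := \prod_(j < n) (1 - A * p ^+ j).

Definition qpochinf A q : C := limn (qpoch A q).

Definition qexp q t : C :=
  limn (series (fun k => q ^+ 'C(k, 2) * t ^+ k / qpoch q q k)).

(* derive1 written out: the postfix notation for it is shadowed by that of
   polynomial derivatives. *)
Definition qexp' q : C -> C := derive1 (qexp q).

Definition ASC_z n z a b p : C :=
  a ^- n * \sum_(k < n.+1)
    qpoch (p ^- n) p k * qpoch (a * z) p k * qpoch (a * z^-1) p k
      * qpoch (a * b * p ^+ k) p (n - k) / qpoch p p k * p ^+ k.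

(* One of the two solutions of x = (z + z^-1) / 2, the other one being its
   inverse; ASC below does not depend on this choice, see ASC_zE. *)
Definition joukowski_inv x : C := x + sqrtC (x ^+ 2 - 1).

Definition ASC n x a b p : C := ASC_z n (joukowski_inv x) a b p.

Lemma ASC_zV n z a b p : ASC_z n z^-1 a b p = ASC_z n z a b p.
Proof.
rewrite /ASC_z invrK; congr (_ * _); apply: eq_bigr => k _.
by rewrite -!mulrA; congr (_ * _); rewrite mulrCA.
Qed.

Lemma ASC_zE n z a b p : z != 0 ->
  ASC n ((z + z^-1) / 2) a b p = ASC_z n z a b p.
Proof.
move=> z0; rewrite /ASC /joukowski_inv.
set x := (z + z^-1) / 2; set s := sqrtC _.
have two0 : (2 : C) != 0 by rewrite pnatr_eq0.
have hx : x *+ 2 = z + z^-1 by rewrite -mulr_natr mulfVK.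
have hs : s ^+ 2 = x ^+ 2 - 1 by rewrite sqrtCK.
have : (x + s - z) * (x + s - z^-1) = 0.
  have -> : (x + s - z) * (x + s - z^-1)
            = s ^+ 2 + x * (x *+ 2 - (z + z^-1)) + s * (x *+ 2 - (z + z^-1))
              - x ^+ 2 + z * z^-1 by ring.
  by rewrite hx subrr !mulr0 hs divff //; ring.
move/eqP; rewrite mulf_eq0 !subr_eq0 => /orP[] /eqP ->; first by [].
exact: ASC_zV.
Qed.

Definition lambda z a q : C :=
  z * qexp' q (- (z / a)) / (a * qpochinf (z / a) q)
  + qexp' q (- (1 / (a * z))) / (z * a * qpochinf (1 / (a * z)) q)
  - 2 * q * qexp' q (- q) / qpochinf q q.

(* lead z b a gives the term with the roles of a and b exchanged. *)
Definition lead z a b q n : C :=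
  (- a) ^+ n * (qpochinf (z / a) q * qpochinf (1 / (a * z)) q)
    / qpochinf (b / a) q.

(* The third branch is reached only when |a| = |b|.  In the last branch lambda
   is meaningful only if (z/a;q)_oo and (1/(az);q)_oo are nonzero (x / 0 = 0 in
   the library). *)
Definition Tn z a b q n : C :=
  if `|a| < `|b| then lead z b a q n
  else if `|b| < `|a| then lead z a b q n
  else if a != b then lead z a b q n + lead z b a q n
  else (n%:R + 1 + lambda z a q) * (- a) ^+ n
         * (qpochinf (z / a) q * qpochinf (1 / (a * z)) q) / qpochinf q q.

End AlSalamChihara.

(* Main.v *)
Require Import Defs.
From HB Require Import structures.
From mathcomp Require Import all_boot all_order all_algebra.
From mathcomp Require Import complex.
From mathcomp Require Import all_classical all_reals all_analysis.
From mathcomp Require Import ring.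

(** Write (A)_n for the q-shifted factorial, E for the q-exponential function, and
    M for the larger one of |a| and |b|.

    Up to the factor (-1)^n q^(-C(n,2)) (q)_n, the polynomial Q_n is the
    coefficient c_n of u^n in
      F(u) = (zu)_oo (u/z)_oo / ((au)_oo (bu)_oo),
    whose poles lie among the points q^(-j)/a and q^(-j)/b; the theorem is
    Darboux's method applied to 1/a and 1/b.

    The link with F is a three-term recurrence.  After every factorial of base
    1/q has been turned around into one of base q ([ASC_ccoef]), the terms of the
    defining sum satisfy the recurrence up to a telescoping difference
    ([ccoef_telescope]).  In terms of F(u) = sum c_n u^n the recurrence says
      (1 - au)(1 - bu) F(u) = (1 - zu)(1 - u/z) F(qu)     ([ccoef_quadmul]),
    and iterating it down to F(0) = 1 gives the product formula
    ([psum_ccoefE]).  The same argument with one factor gives Euler's identity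
    (A)_oo = E(-A) ([cvg_qpoch]), so that all products are values of one entire
    function.

    Let H(u) = (1 - au)(1 - bu) F(u), with coefficients h_k.  By the functional
    equation H is a polynomial multiple of F(qu), so it converges beyond the circle
    |u| = 1/M and h_k M^(-k) decays geometrically.  Dividing by (1 - au)(1 - bu),
    c_n is a combination of the sums over k <= n of h_k w^(n-k) with w = a or
    w = b.  If |w| = M such a sum is w^n H(1/w), and if |w| < M it is 0, up to
    O(M^n r^n) with r < 1 ([pole_on], [pole_in]).  If a = b the weights are
    (n-k+1) a^(n-k) and H'(1/a) enters as well ([pole_double]); the number
    lambda is - H'(1/a) / (a H(1/a)), the logarithmic derivative of the product
    formula for H ([lambdaE]).  Replacing (q)_n by (q)_oo costs O(|q|^n).  All
    errors are thus M^n times a geometrically decaying sequence, which is more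
    than the O(M^n / n) of the statement.

    The error is negligible against T_n as soon as |T_n| is at least a constant
    times M^n ([Tn_lower]); this can only fail when the leading factor vanishes
    or when |a| = |b| with a <> b, where the two terms of T_n may cancel. *)

Set Implicit Arguments.
Unset Strict Implicit.
Unset Printing Implicit Defensive.

Import Order.TTheory GRing.Theory Num.Theory.
Import numFieldNormedType.Exports.

Local Open Scope classical_set_scope.
Local Open Scope ring_scope.

(** * Geometrically decaying complex sequences *)

Section ComplexSequences.
Variable R : realType.
Local Notation C := (Cplx R).
Implicit Types (f g u : nat -> C) (x y K r : C) (n : nat).

(** Bounds the complex modulus by real quantities: convergence in C is
    reduced to that of the real and imaginary parts. *)
Lemma norm_re_im x : `|x| <= (`|complex.Re x| + `|complex.Im x|)%:C%C :> C.
Proof.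
case: x => xr xi; rewrite [X in X <= _]normc_def /= lecR.
rewrite -[leRHS]ger0_norm ?addr_ge0 // -sqrtr_sqr ler_wsqrtr // sqrrD.
by rewrite !real_normK ?num_real // lerD2r lerDl mulrn_wge0 // mulr_ge0.
Qed.

Lemma ge0_ReE x : 0 <= x -> x = (complex.Re x)%:C%C.
Proof. by move=> x0; rewrite RRe_real // ger0_real. Qed.

Lemma abs_re_le x y : `|x| <= y -> `|complex.Re x| <= complex.Re y.
Proof.
move=> xy; have yE := ge0_ReE (le_trans (normr_ge0 _) xy).
by rewrite -lecR -yE; apply: le_trans xy; exact: normc_ge_Re.
Qed.

Lemma abs_im_le x y : `|x| <= y -> `|complex.Im x| <= complex.Re y.
Proof.
move=> xy; have yE := ge0_ReE (le_trans (normr_ge0 _) xy).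
rewrite -lecR -yE; apply: le_trans xy.
case: x => xr xi; rewrite [leRHS]normc_def /= lecR.
by rewrite -sqrtr_sqr ler_wsqrtr // lerDr sqr_ge0.
Qed.

(** The Archimedean property of the reals, for the real elements of C. *)
Lemma natr_gt x : 0 <= x -> exists n : nat, x < n%:R.
Proof.
move=> x0; exists (Num.bound (complex.Re x)).
have re0 : 0 <= complex.Re x by have := ge0_ReE x0 => xE; rewrite -lecR -xE.
by rewrite (ge0_ReE x0) -[ltRHS](rmorph_nat (real_complex R)) ltcR archi_boundP.
Qed.

(** Each error estimate below is of this kind.  The class is stable under sums,
    convolution, multiplication by bounded sequences and by n, so that no rate of
    decay has to be followed through a computation. *)
Definition geo f := exists K r : C, [/\ 0 < K, 0 < r, r < 1 &
  forall n, `|f n| <= K * r ^+ n].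

Lemma geom_sum_le r n : 0 < r -> r < 1 -> \sum_(k < n) r ^+ k <= (1 - r)^-1.
Proof.
move=> r0 r1; rewrite -[leRHS]mul1r ler_pdivlMr ?subr_gt0 // mulrC.
have -> : (1 - r) * (\sum_(k < n) r ^+ k) = 1 - r ^+ n.
  by rewrite -[1 - r]opprB mulNr -subrX1 opprB.
by rewrite gerBl exprn_ge0 // ltW.
Qed.

(** Completeness of C: the real and the imaginary parts are absolutely
    convergent real series, by comparison with a geometric one. *)
Lemma geo_cvg f : geo f -> cvgn (series f).
Proof.
move=> [K [r [K0 r0 r1 fK]]].
have KE := ge0_ReE (ltW K0); have rE := ge0_ReE (ltW r0).
set K' := complex.Re K in KE; set r' := complex.Re r in rE.
have r'0 : 0 < r' by rewrite -ltcR -rE.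
have r'1 : r' < 1 by rewrite -ltcR -rE.
have K'0 : 0 < K' by rewrite -ltcR -KE.
have ReE n : complex.Re (K * r ^+ n) = K' * r' ^+ n.
  by rewrite {1}KE {1}rE -rmorphXn -rmorphM.
have gc : cvgn (series (geometric K' r')).
  by apply: is_cvg_geometric_series; rewrite gtr0_norm.
have aux (g : nat -> R) : (forall n, `|g n| <= K' * r' ^+ n) -> cvgn (series g).
  move=> gK; apply: normed_cvg; apply: series_le_cvg gc => // n.
    exact: normr_ge0.
  by apply: mulr_ge0; rewrite ?exprn_ge0 // ltW.
have cr : cvgn (series (fun m => complex.Re (f m))).
  by apply: aux => n; rewrite -ReE; apply: abs_re_le.
have ci : cvgn (series (fun m => complex.Im (f m))).
  by apply: aux => n; rewrite -ReE; apply: abs_im_le.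
pose l : C := Complex (limn (series (fun m => complex.Re (f m))))
  (limn (series (fun m => complex.Im (f m)))).
have sE n : series f n = Complex (series (fun m => complex.Re (f m)) n)
    (series (fun m => complex.Im (f m)) n).
  rewrite !seriesEnat /=; elim: n => [|n IH]; first by rewrite !big_geq.
  by rewrite !big_nat_recr //= IH; case: (f n).
apply/cvg_ex; exists l; apply/cvgrPdist_le => e e0.
have eE := ge0_ReE (ltW e0); set e' := complex.Re e in eE.
have e'0 : 0 < e' by rewrite -ltcR -eE.
have e2 : 0 < e' / 2 by rewrite divr_gt0.
move/cvgrPdist_le: cr => /(_ _ e2) cr; move/cvgrPdist_le: ci => /(_ _ e2) ci.
near=> n; rewrite sE; apply: le_trans (norm_re_im _) _.
rewrite eE lecR /l /= (splitr e') lerD //.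
  by near: n.
by near: n.
Unshelve. all: by end_near. Qed.

End ComplexSequences.

Section Geo.
Variable R : realType.
Local Notation C := (Cplx R).
Implicit Types (f g u : nat -> C) (x y K r : C) (n : nat).

(** The order on C is only partial, but an upper bound of a norm is real, so
    that the bound can be refuted as in an ordered field. *)
Lemma lim_dist_le u l x K : u @ \oo --> l ->
  (\forall n \near \oo, `|u n - x| <= K) -> `|l - x| <= K.
Proof.
move=> ul uK.
have K0 : 0 <= K.
  by have [N _ /(_ N (leqnn N))] := uK; apply: le_trans.
rewrite real_leNgt ?ger0_real //; apply/negP => Kl.
have e0 : 0 < `|l - x| - K by rewrite subr_gt0.
move/cvgrPdist_lt: ul => /(_ _ e0) ul.
have [N _ /(_ N (leqnn N)) [h1 h2]] : \forall n \near \oo,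
    `|l - u n| < `|l - x| - K /\ `|u n - x| <= K.
  by near=> n; split; near: n.
have := ler_distD (u N) l x.
move/(le_lt_trans)/(_ (ltr_leD h1 h2)).
by rewrite subrK ltxx.
Unshelve. all: by end_near. Qed.

Lemma geo_tail f K r : 0 < K -> 0 < r -> r < 1 ->
  (forall n, `|f n| <= K * r ^+ n) ->
  forall n, `|limn (series f) - series f n| <= K / (1 - r) * r ^+ n.
Proof.
move=> K0 r0 r1 fK n.
have cf : cvgn (series f) by apply: geo_cvg; exists K, r.
apply: lim_dist_le cf _; near=> N.
have nN : (n <= N)%N by near: N; exact: nbhs_infty_ge.
rewrite sub_series_geq // -{1}[n]add0n big_addn big_mkord.
apply: le_trans (ler_norm_sum _ _ _) _.
apply: (@le_trans _ _ (\sum_(i < N - n) (K * r ^+ n) * r ^+ i)).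
  by apply: ler_sum => i _; rewrite -mulrA -exprD addnC.
rewrite -mulr_sumr [leRHS]mulrAC ler_wpM2l ?geom_sum_le //.
by rewrite mulr_ge0 ?exprn_ge0 // ltW.
Unshelve. all: by end_near. Qed.

Lemma geo_le f g K : geo g -> (forall n, `|f n| <= K * `|g n|) -> geo f.
Proof.
move=> [L [r [L0 r0 r1 gL]]] fg.
exists ((`|K| + 1) * L), r; split => //.
  by rewrite mulr_gt0 // ltr_wpDl.
move=> n; have [g0|g0] := eqVneq (g n) 0.
  have := fg n; rewrite g0 normr0 mulr0 => /le_trans; apply.
  by rewrite !mulr_ge0 ?addr_ge0 ?exprn_ge0 // ltW.
have gn0 : 0 < `|g n| by rewrite normr_gt0.
have K0 : 0 <= K by rewrite -(pmulr_lge0 _ gn0) (le_trans _ (fg n)).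
apply: le_trans (fg n) _; rewrite -mulrA ler_pM //.
by rewrite (ger0_norm K0) lerDl.
Qed.

Lemma geo_ext f g : (forall n, f n = g n) -> geo g -> geo f.
Proof. by move=> fg gg; apply: (@geo_le _ _ 1) gg _ => n; rewrite mul1r fg. Qed.

Lemma geo_mull f g K : (forall n, `|f n| <= K) -> geo g ->
  geo (fun n => f n * g n).
Proof.
by move=> fK gg; apply: (@geo_le _ _ K) gg _ => n; rewrite normrM ler_wpM2r.
Qed.

Lemma geoZ f x : geo f -> geo (fun n => x * f n).
Proof. exact: (@geo_mull (fun=> x) f `|x|). Qed.

Lemma geoD f g : geo f -> geo g -> geo (fun n => f n + g n).
Proof.
move=> [K [r [K0 r0 r1 fK]]] [L [s [L0 s0 s1 gL]]].
(* A rate below 1 that dominates both r and s. *)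
have tE : r + s - r * s = 1 - (1 - r) * (1 - s) by ring.
have rt : r <= r + s - r * s.
  by rewrite -addrA lerDl subr_ge0 ler_piMl // ltW.
have st : s <= r + s - r * s.
  by rewrite [r + s]addrC -addrA lerDl subr_ge0 ler_piMr // ltW.
exists (K + L), (r + s - r * s); split => //.
- by rewrite addr_gt0.
- exact: lt_le_trans rt.
- by rewrite tE gtrBl mulr_gt0 ?subr_gt0.
move=> n; rewrite mulrDl; apply: le_trans (ler_normD _ _) (lerD _ _).
  apply: le_trans (fK n) _; rewrite ler_pM2l // lerXn2r ?nnegrE //; apply: ltW => //.
  exact: lt_le_trans rt.
apply: le_trans (gL n) _; rewrite ler_pM2l // lerXn2r ?nnegrE //; apply: ltW => //.
exact: lt_le_trans rt.
Qed.

Lemma geoB f g : geo f -> geo g -> geo (fun n => f n - g n).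
Proof.
move=> gf gg; apply: (@geo_ext _ (fun n => f n + (-1) * g n)).
  by move=> n; rewrite mulN1r.
by apply: geoD => //; apply: geoZ.
Qed.

Lemma geo_shift f : geo f -> geo (fun n => f n.+1).
Proof.
move=> [K [r [K0 r0 r1 fK]]]; exists K, r; split => // n.
apply: le_trans (fK _) _; rewrite ler_pM2l // exprS ler_piMl ?exprn_ge0 //; exact: ltW.
Qed.

Lemma geo_unshift f : geo (fun n => f n.+1) -> geo f.
Proof.
move=> [K [r [K0 r0 r1 fK]]]; exists (`|f 0%N| + K / r), r; split => //.
  by rewrite ltr_wpDl // divr_gt0.
case=> [|n]; first by rewrite expr0 mulr1 lerDl ltW ?divr_gt0 //.
apply: le_trans (fK _) _; rewrite exprS mulrA mulrDl mulfVK ?gt_eqF // mulrDl.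
by rewrite lerDr !mulr_ge0 ?exprn_ge0 // ltW.
Qed.

Lemma geo_expr x : `|x| < 1 -> geo (fun n => x ^+ n).
Proof.
move=> x1; exists 1, ((1 + `|x|) / 2); split => //.
  by rewrite addrC; have [] := midf_lt x1.
move=> n; rewrite mul1r normrX lerXn2r ?nnegrE //.
by rewrite addrC; have [] := midf_le (ltW x1).
Qed.

Lemma geo_bounded f : geo f -> exists2 K, 0 < K & forall n, `|f n| <= K.
Proof.
move=> [K [r [K0 r0 r1 fK]]]; exists K => // n; apply: le_trans (fK n) _.
by rewrite ler_piMr ?exprn_ile1 // ltW.
Qed.

Lemma bernoulli x n : 0 <= x -> 1 + n%:R * x <= (1 + x) ^+ n.
Proof.
move=> x0; elim: n => [|n IH]; first by rewrite mul0r addr0 expr0.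
rewrite exprS; apply: le_trans (_ : (1 + x) * (1 + n%:R * x) <= _); last first.
  by rewrite ler_wpM2l ?addr_ge0.
have -> : (1 + x) * (1 + n%:R * x) = 1 + n.+1%:R * x + n%:R * (x * x).
  by rewrite -[n.+1%:R]natr1; ring.
by rewrite lerDl !mulr_ge0.
Qed.

(** Bernoulli's inequality bounds n by a multiple of (1 + d)^n for any d > 0, so
    the factor n only enlarges the rate r to (1 + d) r; here d is chosen so that
    the new rate is the midpoint of r and 1. *)
Lemma geo_muln f : geo f -> geo (fun n => n%:R * f n).
Proof.
move=> [K [r [K0 r0 r1 fK]]].
pose d := (1 - r) / (2 * r).
have d0 : 0 < d by rewrite divr_gt0 ?subr_gt0 // mulr_gt0.
have dr : (1 + d) * r = (r + 1) / 2.
  by rewrite /d; field; rewrite gt_eqF.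
have [h1 h2] := midf_lt r1.
exists (K / d), ((r + 1) / 2); split => //.
- by rewrite divr_gt0.
- exact: lt_trans h1.
move=> n; rewrite normrM ger0_norm // -dr exprMn.
have hn : n%:R <= d^-1 * (1 + d) ^+ n.
  rewrite ler_pdivlMl // mulrC; apply: le_trans (bernoulli n (ltW d0)).
  by rewrite lerDr.
have -> : K / d * ((1 + d) ^+ n * r ^+ n) = d^-1 * (1 + d) ^+ n * (K * r ^+ n) by ring.
by rewrite ler_pM.
Qed.

Lemma geo_cvg0 f : geo f -> f @ \oo --> (0 : C).
Proof. by move=> gf; apply/cvg_series_cvg_0/geo_cvg. Qed.

Lemma geo_tail_geo f : geo f -> geo (fun n => limn (series f) - series f n).
Proof.
move=> [K [r [K0 r0 r1 fK]]]; exists (K / (1 - r)), r; split => //.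
  by rewrite divr_gt0 ?subr_gt0.
exact: geo_tail.
Qed.

End Geo.

(** * Complex power series *)

Section PowerSeries.
Variable R : realType.
Local Notation C := (Cplx R).
Implicit Types (f g : nat -> C) (u v w x y K r : C) (n k : nat).

Lemma limnE (s : nat -> C) l : s @ \oo --> l -> limn s = l.
Proof. by apply: cvg_lim. Qed.

Lemma cvgnD (s t : nat -> C) (a b : C) : s @ \oo --> a -> t @ \oo --> b ->
  (fun n => s n + t n) @ \oo --> a + b.
Proof. exact: cvgD. Qed.

Lemma cvgnZ (s : nat -> C) (x a : C) : s @ \oo --> a ->
  (fun n => x * s n) @ \oo --> x * a.
Proof. exact: cvgMl_tmp. Qed.

Lemma cvgnM (s t : nat -> C) (a b : C) : s @ \oo --> a -> t @ \oo --> b ->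
  (fun n => s n * t n) @ \oo --> a * b.
Proof. exact: cvgM. Qed.

Lemma limn_unique (s : nat -> C) (l l' : C) :
  s @ \oo --> l -> s @ \oo --> l' -> l = l'.
Proof. by move=> /limnE <- /limnE <-. Qed.

Lemma cvgn_cst (x : C) : (fun _ : nat => x) @ \oo --> x.
Proof. exact: cvg_cst. Qed.

Definition psum f u : C := limn (series (fun k => f k * u ^+ k)).

(** Convergence is required at a modulus larger than |u|: this is an open
    condition on u, and it allows differentiation under the sum. *)
Definition pconv f u := exists2 w : C, `|u| < w & geo (fun k => f k * w ^+ k).

Lemma geo_radius f w u : `|u| <= w -> geo (fun k => f k * w ^+ k) ->
  geo (fun k => f k * u ^+ k).
Proof.
move=> uw gw; apply: (geo_le (K := 1)) gw _ => n.
have w0 : 0 <= w by apply: le_trans uw.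
by rewrite mul1r !normrM !normrX ler_wpM2l // lerXn2r ?nnegrE // (ger0_norm w0).
Qed.

Lemma pconv_geo f u : pconv f u -> geo (fun k => f k * u ^+ k).
Proof. by move=> [w uw gw]; exact: geo_radius (ltW uw) gw. Qed.

(** Abel's lemma. *)
Lemma pconv_bounded f u v K : `|u| < `|v| ->
  (forall k, `|f k| * `|v| ^+ k <= K) -> pconv f u.
Proof.
move=> uv fK; have [h1 h2] := midf_lt uv.
set w := (`|u| + `|v|) / 2 in h1 h2.
have w0 : 0 <= w by rewrite ltW // (le_lt_trans _ h1).
have v0 : 0 < `|v| by apply: le_lt_trans uv.
exists w => //.
have gx : geo (fun k => (w / `|v|) ^+ k).
  by apply: geo_expr; rewrite ger0_norm ?divr_ge0 // ltr_pdivrMr // mul1r.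
apply: geo_ext (geo_mull (K := K) (f := fun k => f k * `|v| ^+ k) _ gx) => k /=.
  by rewrite -mulrA -exprMn [`|v| * _]mulrC divfK ?gt_eqF.
by rewrite normrM normrX normr_id.
Qed.

Lemma psum_ext f g u : (forall k, f k = g k) -> psum f u = psum g u.
Proof. by move/funext => ->. Qed.

Lemma seriesE f n : series f n = \sum_(k < n) f k.
Proof. by rewrite seriesEnat /= big_mkord. Qed.

Lemma geo_limD f g : geo f -> geo g ->
  limn (series (fun k => f k + g k)) = limn (series f) + limn (series g).
Proof.
move=> /geo_cvg cf /geo_cvg cg; have h := cvgnD cf cg.
have e : (fun n => series f n + series g n) = series (fun k => f k + g k).
  by apply/funext => n; rewrite !seriesE big_split.
by rewrite -e; apply: limnE.
Qed.

Lemma geo_limZ f x : geo f ->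
  limn (series (fun k => x * f k)) = x * limn (series f).
Proof.
move=> /geo_cvg cf; have h := cvgnZ (x := x) cf.
have e : (fun n => x * series f n) = series (fun k => x * f k).
  by apply/funext => n; rewrite !seriesE mulr_sumr.
by rewrite -e; apply: limnE.
Qed.

Lemma geo_limB f g : geo f -> geo g ->
  limn (series (fun k => f k - g k)) = limn (series f) - limn (series g).
Proof.
move=> gf gg; rewrite -[- limn _]mulN1r -geo_limZ // -geo_limD //; last exact: geoZ.
by congr (limn (series _)); apply/funext => k; rewrite mulN1r.
Qed.

Lemma geo_limS f : geo f ->
  limn (series f) = f 0%N + limn (series (fun k => f k.+1)).
Proof.
move=> gf; apply: limnE; rewrite -cvg_shiftS.
have h := cvgnD (cvgn_cst (x := f 0%N)) (geo_cvg (geo_shift gf)).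
have e : (fun n => f 0%N + series (fun k => f k.+1) n) = [sequence series f n.+1]_n.
  by apply/funext => n; rewrite /= !seriesE big_ord_recl.
by rewrite -e; exact: h.
Qed.

Lemma psumD f g u : geo (fun k => f k * u ^+ k) -> geo (fun k => g k * u ^+ k) ->
  psum (fun k => f k + g k) u = psum f u + psum g u.
Proof.
move=> gf gg; rewrite /psum -geo_limD //; congr (limn (series _)).
by apply/funext => k; rewrite mulrDl.
Qed.

Lemma psumZ f x u : geo (fun k => f k * u ^+ k) ->
  psum (fun k => x * f k) u = x * psum f u.
Proof.
move=> gf; rewrite /psum -geo_limZ //; congr (limn (series _)).
by apply/funext => k; rewrite mulrA.
Qed.

Lemma psum0 f : psum f 0 = f 0%N.
Proof.
rewrite /psum geo_limS; last first.
  apply: geo_unshift; apply: geo_ext (geoZ 0 (geo_expr (x := 0) _)).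
    by move=> n; rewrite exprS !mul0r mulr0.
  by rewrite normr0.
rewrite expr0 mulr1 (_ : (fun k => _) = fun=> 0); last first.
  by apply/funext => k; rewrite exprS mul0r mulr0.
rewrite (_ : series _ = cst 0) ?lim_cst ?addr0 //.
by apply/funext => n; rewrite seriesE big1.
Qed.

(** Coefficients of u f(u). *)
Definition mulX f k := if k is j.+1 then f j else 0.

Lemma geo_mulX f u : geo (fun k => f k * u ^+ k) ->
  geo (fun k => mulX f k * u ^+ k).
Proof.
move=> gf; apply: geo_unshift; apply: geo_ext (geoZ u gf) => k /=.
by rewrite exprS mulrCA.
Qed.

Lemma psum_mulX f u : geo (fun k => f k * u ^+ k) ->
  psum (mulX f) u = u * psum f u.
Proof.
move=> gf; rewrite /psum geo_limS ?mul0r ?add0r; last exact: geo_mulX.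
rewrite -geo_limZ //; congr (limn (series _)).
by apply/funext => k /=; rewrite exprS mulrCA.
Qed.

(** Coefficients of (1 - A u + B u^2) f(u). *)
Definition quadmul A B f k : C := f k - A * mulX f k + B * mulX (mulX f) k.

Lemma geo_quadmul A B f u : geo (fun k => f k * u ^+ k) ->
  geo (fun k => quadmul A B f k * u ^+ k).
Proof.
move=> gf; have g1 := geo_mulX gf; have g2 := geo_mulX g1.
apply: geo_ext (geoD (geoB gf (geoZ A g1)) (geoZ B g2)) => k.
by rewrite /quadmul !mulrA mulrDl mulrBl.
Qed.

Lemma psum_quadmul A B f u : geo (fun k => f k * u ^+ k) ->
  psum (quadmul A B f) u = (1 - A * u + B * u ^+ 2) * psum f u.
Proof.
move=> gf; have g1 := geo_mulX gf; have g2 := geo_mulX g1.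
have gA : geo (fun k => (- A * mulX f k) * u ^+ k).
  by apply: geo_ext (geoZ (- A) g1) => k; rewrite mulrA.
have gB : geo (fun k => (B * mulX (mulX f) k) * u ^+ k).
  by apply: geo_ext (geoZ B g2) => k; rewrite mulrA.
rewrite (psum_ext
  (g := fun k => (f k + - A * mulX f k) + B * mulX (mulX f) k)); last first.
  by move=> k; rewrite /quadmul mulNr.
rewrite psumD //; last first.
  by apply: geo_ext (geoD gf gA) => k; rewrite mulrDl.
by rewrite psumD // !psumZ // !psum_mulX //; ring.
Qed.

Lemma pconv_quadmul A B f u : pconv f u -> pconv (quadmul A B f) u.
Proof. by move=> [w uw gw]; exists w => //; apply: geo_quadmul. Qed.

Lemma psum_scale f q u : psum (fun k => q ^+ k * f k) u = psum f (q * u).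
Proof.
rewrite /psum; congr (limn (series _)); apply/funext => k.
by rewrite exprMn mulrAC mulrA [f k * _]mulrC mulrAC.
Qed.

Lemma pconv_scale f q u : q != 0 -> pconv f (q * u) ->
  pconv (fun k => q ^+ k * f k) u.
Proof.
move=> q0 [w uw gw]; have nq : 0 < `|q| by rewrite normr_gt0.
exists (w / `|q|); first by rewrite ltr_pdivlMr // mulrC -normrM.
apply: (geo_le (K := 1)) gw _ => n.
rewrite mul1r expr_div_n !normrM normfV !normrX normr_id.
have nz : `|q| ^+ n != 0 by rewrite expf_neq0 ?gt_eqF.
by rewrite [leLHS](_ : _ = `|f n| * `|w| ^+ n) //; field.
Qed.

(** The second-order Taylor remainder of x^n, by induction on n from
    R_(n+1) = x R_n + n (x - u)^2 u^(n-1).  The factor w^2 on the left spares an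
    exponent n - 2 on the right. *)
Lemma taylor2_le x u w n : 0 < w -> `|x| <= w -> `|u| <= w ->
  w ^+ 2 * `|x ^+ n - u ^+ n - n%:R * (x - u) * u ^+ n.-1|
    <= n%:R ^+ 2 * `|x - u| ^+ 2 * w ^+ n.
Proof.
move=> w0 xw uw; have w0' := ltW w0.
elim: n => [|n IH].
  by rewrite !expr0 subrr mul0r mul0r subrr normr0 mulr0 expr0n /= !mul0r.
have -> : x ^+ n.+1 - u ^+ n.+1 - n.+1%:R * (x - u) * u ^+ n
   = x * (x ^+ n - u ^+ n - n%:R * (x - u) * u ^+ n.-1)
     + n%:R * (x - u) ^+ 2 * u ^+ n.-1.
  case: n {IH} => [|n]; first by rewrite !expr0 !expr1; ring.
  rewrite /= -[n.+2%:R]natr1 !exprS; ring.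
apply: (@le_trans _ _ (w * (n%:R ^+ 2 * `|x - u| ^+ 2 * w ^+ n)
     + n%:R * `|x - u| ^+ 2 * w ^+ n.+1)).
  apply: le_trans (ler_wpM2l _ (ler_normD _ _)) _; first by rewrite exprn_ge0.
  rewrite mulrDr lerD //.
    rewrite normrM mulrCA; apply: ler_pM => //.
    by rewrite mulr_ge0 // exprn_ge0.
  case: n {IH} => [|n]; first by rewrite !mul0r normr0 mulr0.
  rewrite /= !normrM normr_nat !normrX mulrCA ler_wpM2l //.
  by rewrite !exprS expr0 mulr1 -mulrA !ler_wpM2l // lerXn2r ?nnegrE.
have -> : n.+1%:R ^+ 2 * `|x - u| ^+ 2 * w ^+ n.+1 =
  w * (n%:R ^+ 2 * `|x - u| ^+ 2 * w ^+ n) + n%:R * `|x - u| ^+ 2 * w ^+ n.+1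
  + n.+1%:R * `|x - u| ^+ 2 * w ^+ n.+1.
  by rewrite -[n.+1%:R]natr1 [w ^+ n.+1]exprS; ring.
by rewrite lerDl !mulr_ge0 // exprn_ge0.
Qed.

Lemma is_derive_quad (g : C -> C) u D K r : 0 < r ->
  (forall x, `|x - u| <= r -> `|g x - g u - (x - u) * D| <= K * `|x - u| ^+ 2) ->
  is_derive (u : C) (1 : C) g D.
Proof.
move=> r0 gK.
have K0 : 0 <= K.
  have := gK (u + r); rewrite addrAC subrr add0r gtr0_norm // => /(_ (lexx _)).
  by move/(le_trans (normr_ge0 _)); rewrite pmulr_lge0 ?exprn_gt0.
have cD : (fun h : C => h^-1 *: ((g \o shift u) (h *: (1 : C)) - g u)) @ 0^' --> (D : C).
  apply/cvgrPdist_le => e e0; near=> h.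
  have h0 : h != 0 by near: h; exact: nbhs_dnbhs_neq.
  have hr : `|h| <= r by near: h; exact: dnbhs0_le.
  have he : `|h| <= e / (K + 1).
    by near: h; apply: dnbhs0_le; rewrite divr_gt0 // ltr_wpDl.
  have hn0 : 0 < `|h| by rewrite normr_gt0.
  have := gK (h + u); rewrite addrK => /(_ hr) hK.
  rewrite /shift /= [h *: _]mulr1 -[_ *: _]/(_ * _).
  rewrite (_ : D - _ = - (h^-1 * (g (h + u) - g u - h * D))); last first.
    by field.
  rewrite normrN normrM normfV ler_pdivrMl //.
  apply: le_trans hK _; rewrite expr2 mulrCA ler_wpM2l //.
  apply: le_trans (ler_wpM2l K0 he) _.
  by rewrite mulrCA ler_piMr ?(ltW e0) // ler_pdivrMr ?ltr_wpDl // mul1r lerDl.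
apply: (@DeriveDef _ _ _ u 1 g D).
  by apply: cvgP; exact: cD.
rewrite /derive.
apply: (@cvg_lim C (@norm_hausdorff C C)).
exact: cD.
Unshelve. all: by end_near. Qed.

Lemma geo_deriv f w : w != 0 -> geo (fun k => f k * w ^+ k) ->
  geo (fun k => k.+1%:R * f k.+1 * w ^+ k).
Proof.
move=> w0 /geo_muln /geo_shift gw; apply: geo_ext (geoZ w^-1 gw) => k.
by rewrite exprS; field.
Qed.

Lemma geo_sum_bounded f : geo f -> exists K, forall n, \sum_(k < n) `|f k| <= K.
Proof.
move=> [K [r [K0 r0 r1 fK]]]; exists (K * (1 - r)^-1) => n.
apply: (@le_trans _ _ (\sum_(k < n) K * r ^+ k)); first exact: ler_sum.
by rewrite -mulr_sumr ler_wpM2l ?geom_sum_le // ltW.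
Qed.

(** The remainders of the monomials are summed against the coefficients; the
    sum of k^2 |f_k| w^k is finite because the terms f_k w^k decay
    geometrically. *)
Lemma psum_quad f u w : geo (fun k => f k * w ^+ k) -> 0 < w -> `|u| <= w ->
  exists K, forall x, `|x| <= w ->
   `|psum f x - psum f u - (x - u) * psum (fun k => k.+1%:R * f k.+1) u|
     <= K * `|x - u| ^+ 2.
Proof.
move=> gw w0 uw.
have gu := geo_radius uw gw.
have gd := geo_radius uw (geo_deriv (negbT (gt_eqF w0)) gw).
have [B gB] := geo_sum_bounded (geo_muln (geo_muln gw)).
exists (w ^- 2 * B) => x xw.
have gx := geo_radius xw gw.
pose d k := k%:R * (x - u) * u ^+ k.-1 * f k.
have gd' : geo d.
  by apply: geo_unshift; apply: geo_ext (geoZ (x - u) gd) => k; rewrite /d /=; ring.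
have dE : (x - u) * psum (fun k => k.+1%:R * f k.+1) u = limn (series d).
  rewrite geo_limS // /d !mul0r add0r /psum -geo_limZ //.
  by congr (limn (series _)); apply/funext => k /=; ring.
pose D k := f k * (x ^+ k - u ^+ k - k%:R * (x - u) * u ^+ k.-1).
have DE k : f k * x ^+ k - f k * u ^+ k - d k = D k by rewrite /D /d; ring.
have gD : geo D by apply: geo_ext (geoB (geoB gx gu) gd') => k; rewrite DE.
have -> : psum f x - psum f u - (x - u) * psum (fun k => k.+1%:R * f k.+1) u
    = limn (series D).
  rewrite dE /psum -geo_limB // -geo_limB //; last exact: geoB.
  by congr (limn (series _)); apply/funext => k; rewrite -DE.
rewrite -[limn _]subr0; apply: lim_dist_le (geo_cvg gD) _; near=> n.
rewrite subr0 seriesE; apply: le_trans (ler_norm_sum _ _ _) _.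
apply: (@le_trans _ _ (\sum_(k < n) w ^- 2 * `|x - u| ^+ 2 *
    `|k%:R * (k%:R * (f k * w ^+ k))|)); last first.
  rewrite -mulr_sumr mulrAC ler_wpM2r ?exprn_ge0 // ler_wpM2l //.
  by rewrite invr_ge0 exprn_ge0 // ltW.
apply: ler_sum => k _; rewrite /D normrM -[leRHS]mulrA ler_pdivlMl ?exprn_gt0 //.
rewrite mulrCA.
have -> : `|x - u| ^+ 2 * `|k%:R * (k%:R * (f k * w ^+ k))|
   = `|f k| * (k%:R ^+ 2 * `|x - u| ^+ 2 * w ^+ k).
  rewrite !normrM normr_nat normrX (gtr0_norm w0); ring.
by rewrite ler_wpM2l //; apply: taylor2_le.
Unshelve. all: by end_near. Qed.

Lemma psum_derive f u : pconv f u ->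
  is_derive (u : C) (1 : C) (psum f) (psum (fun k => k.+1%:R * f k.+1) u).
Proof.
move=> [w uw gw].
have w0 : 0 < w by apply: le_lt_trans uw.
have [K fK] := psum_quad gw w0 (ltW uw).
apply: (@is_derive_quad _ _ _ K (w - `|u|)); first by rewrite subr_gt0.
move=> x xu; apply: fK; rewrite -[x](subrK u).
by apply: le_trans (ler_normD _ _) _; rewrite -lerBrDr.
Qed.

End PowerSeries.

(** * The q-exponential function *)

Section QExponential.
Variable R : realType.
Local Notation C := (Cplx R).
Implicit Types (f g : nat -> C) (A p q u v w x y K r t : C) (n k : nat).

Lemma pconv_cvg0 f q u : `|q| < 1 -> pconv f 0 ->
  psum f (u * q ^+ n) @[n --> \oo] --> f 0%N.
Proof.
move=> q1 /psum_derive df.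
have cf : {for (0 : C), continuous (psum f)}.
  apply: differentiable_continuous; apply/derivable1_diffP; exact: ex_derive.
have cu : u * q ^+ n @[n --> \oo] --> (0 : C).
  exact: geo_cvg0 (geoZ u (geo_expr q1)).
rewrite -(psum0 f).
exact: (cvg_comp _ _ cu cf).
Qed.

Lemma normX_le1 q n : `|q| < 1 -> `|q ^+ n| <= 1.
Proof. by move=> q1; rewrite normrX exprn_ile1 // ltW. Qed.

Lemma qpochS A p n : qpoch A p n.+1 = qpoch A p n * (1 - A * p ^+ n).
Proof. by rewrite /qpoch big_ord_recr. Qed.

Lemma qpochSl A p n : qpoch A p n.+1 = (1 - A) * qpoch (A * p) p n.
Proof.
rewrite /qpoch big_ord_recl expr0 mulr1; congr (_ * _).
by apply: eq_bigr => i _; rewrite /bump /= exprS mulrA.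
Qed.

Lemma qpoch0 A p : qpoch A p 0 = 1.
Proof. by rewrite /qpoch big_ord0. Qed.

Lemma subr1X_neq0 q n : `|q| < 1 -> 1 - q ^+ n.+1 != 0.
Proof.
move=> q1; rewrite subr_eq0; apply/eqP => e.
have : `|q ^+ n.+1| < 1 by rewrite normrX exprn_ilt1.
by rewrite -e normr1 ltxx.
Qed.

Lemma qpoch_neq0 A q n : `|q| < 1 -> `|A| < 1 -> qpoch A q n != 0.
Proof.
move=> q1 A1; apply/prodf_neq0 => i _; rewrite subr_eq0; apply/eqP => e.
have : `|A * q ^+ i| < 1.
  apply: le_lt_trans A1; rewrite normrM normrX ler_piMr // exprn_ile1 //.
  exact: ltW.
by rewrite -e normr1 ltxx.
Qed.

Definition qexp_coef q k := q ^+ 'C(k, 2) / qpoch q q k.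

Lemma qexpE q t : qexp q t = psum (qexp_coef q) t.
Proof.
rewrite /qexp /psum; congr (limn (series _)); apply/funext => k.
by rewrite /qexp_coef mulrAC.
Qed.

Lemma qexp_coefS q k : `|q| < 1 ->
  qexp_coef q k.+1 * (1 - q ^+ k.+1) = q ^+ k * qexp_coef q k.
Proof.
move=> q1; rewrite /qexp_coef qpochS -exprS binS bin1 exprD.
have := subr1X_neq0 k q1; have := qpoch_neq0 k q1 q1.
by move=> h1 h2; field; rewrite h1 h2.
Qed.

(** A sequence that decreases from the index N on is bounded by the sum of its
    terms up to N. *)
Lemma bounded_of_ratio (s : nat -> C) N : (forall k, 0 <= s k) ->
  (forall k, (N <= k)%N -> s k.+1 <= s k) -> exists K, forall k, s k <= K.
Proof.
move=> s0 sN; exists (\sum_(i < N.+1) s i) => k.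
have le1 i : (i <= N)%N -> s i <= \sum_(i < N.+1) s i.
  move=> iN; rewrite (bigD1 (Ordinal (iN : (i < N.+1)%N))) //= lerDl.
  exact: sumr_ge0.
have [/le1 //|/ltnW Nk] := leqP k N.
apply: le_trans (le1 N _) => //; elim: k Nk => [|k IH]; first by rewrite leqn0 => /eqP ->.
rewrite leq_eqVlt => /orP[/eqP <- //|]; rewrite ltnS => Nk.
exact: le_trans (sN _ Nk) (IH Nk).
Qed.

(** E is entire: the quotient of two consecutive terms is q^k v / (1 - q^(k+1)),
    which tends to 0. *)
Lemma pconv_qexp_coef q u : `|q| < 1 -> pconv (qexp_coef q) u.
Proof.
move=> q1.
have q1' : 0 < 1 - `|q| by rewrite subr_gt0.
have v0 : 0 < `|u| + 1 by rewrite ltr_wpDl.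
have := geo_cvg0 (geo_expr q1); move/cvgrPdist_le => /(_ ((1 - `|q|) / (`|u| + 1))).
case; first by rewrite divr_gt0.
move=> N _ qN.
have [||K hK] := @bounded_of_ratio (fun k => `|qexp_coef q k| * (`|u| + 1) ^+ k) N.
- by move=> k; rewrite mulr_ge0 // exprn_ge0 // ltW.
- move=> k /qN /=; rewrite sub0r normrN ler_pdivlMr // => hk.
  have h1 : 1 - `|q| <= `|1 - q ^+ k.+1|.
    apply: le_trans (lerB_dist _ _); rewrite normr1 lerD2l lerN2 normrX exprS.
    by rewrite ler_piMr // exprn_ile1 // ltW.
  have h2 : 0 < `|1 - q ^+ k.+1| by apply: lt_le_trans h1.
  have e1 : `|1 - q ^+ k.+1| * `|qexp_coef q k.+1| = `|q ^+ k| * `|qexp_coef q k|.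
    by rewrite -normrM mulrC qexp_coefS // normrM.
  rewrite -(ler_pM2l h2) mulrA e1.
  have -> : `|q ^+ k| * `|qexp_coef q k| * (`|u| + 1) ^+ k.+1 =
    (`|qexp_coef q k| * (`|u| + 1) ^+ k) * (`|q ^+ k| * (`|u| + 1)).
    by rewrite exprS; ring.
  rewrite [leRHS]mulrC ler_wpM2l //; exact: le_trans h1.
apply: (pconv_bounded (v := `|u| + 1) (K := K)) => [|k].
  by rewrite (gtr0_norm v0) ltrDl.
by rewrite (gtr0_norm v0).
Qed.

(** On coefficients this is e_k = q^k e_k + q^(k-1) e_(k-1). *)
Lemma qexp_fun q t : q != 0 -> `|q| < 1 ->
  qexp q t = (1 + t) * qexp q (q * t).
Proof.
move=> q0 q1; rewrite !qexpE -psum_scale.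
have pc : pconv (fun k => q ^+ k * qexp_coef q k) t.
  by apply: pconv_scale => //; apply: pconv_qexp_coef.
have := psum_quadmul (-1) 0 (pconv_geo pc).
rewrite mulN1r opprK mul0r addr0 => <-; apply: psum_ext => k.
rewrite /quadmul mul0r addr0 mulN1r opprK; case: k => [|k] /=.
  by rewrite addr0 expr0 mul1r.
by rewrite -(@qexp_coefS q k) //; ring.
Qed.

Lemma qexp_iter q A n : q != 0 -> `|q| < 1 ->
  qexp q (- A) = qpoch A q n * qexp q (- A * q ^+ n).
Proof.
move=> q0 q1; elim: n => [|n ->]; first by rewrite qpoch0 mul1r expr0 mulr1.
rewrite (@qexp_fun q (- A * q ^+ n)) // qpochS mulrA mulNr.
by rewrite exprS -mulNr mulrCA.
Qed.

Lemma cvg_qexp_scale q A : `|q| < 1 -> qexp q (A * q ^+ n) @[n --> \oo] --> (1 : C).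
Proof.
move=> q1; have := pconv_cvg0 A q1 (pconv_qexp_coef 0 q1).
rewrite {2}/qexp_coef expr0 qpoch0 divr1.
have -> // : (fun n => psum (qexp_coef q) (A * q ^+ n)) = (fun n => qexp q (A * q ^+ n)).
by apply/funext => n; rewrite qexpE.
Qed.

Lemma cvgn_neq0 (s : nat -> C) (l : C) : s @ \oo --> l -> l != 0 ->
  \forall n \near \oo, s n != 0.
Proof. by move=> sl l0; apply: cvgr_neq0 sl l0. Qed.

(** Euler's identity (A)_oo = E(-A), together with the convergence of the
    product: E(-A) = (A)_n E(-A q^n), and the last factor tends to E(0) = 1. *)
Lemma cvg_qpoch q A : q != 0 -> `|q| < 1 -> qpoch A q @ \oo --> qexp q (- A).
Proof.
move=> q0 q1; have c1 := @cvg_qexp_scale q (- A) q1.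
have c2 : (qexp q (- A * q ^+ n))^-1 @[n --> \oo] --> (1 : C).
  by rewrite -[X in _ --> X]invr1; apply: cvgV => //; exact: oner_neq0.
have := cvgnZ (x := qexp q (- A)) c2; rewrite mulr1; apply: cvg_trans.
apply: near_eq_cvg; near=> n.
have nz : qexp q (- A * q ^+ n) != 0.
  by near: n; exact: (cvgn_neq0 c1 (oner_neq0 _)).
by rewrite (@qexp_iter q A n) // mulfK.
Unshelve. all: by end_near. Qed.

Lemma qpochinfE q A : q != 0 -> `|q| < 1 -> qpochinf A q = qexp q (- A).
Proof. by move=> q0 q1; apply: limnE; apply: cvg_qpoch. Qed.

(** E(-A) is a partial product without zero factor times a value of E close to
    E(0) = 1. *)
Lemma qexp_neq0 q A : q != 0 -> `|q| < 1 -> `|A| < 1 -> qexp q (- A) != 0.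
Proof.
move=> q0 q1 A1; have c1 := @cvg_qexp_scale q (- A) q1.
have [N _ /(_ N (leqnn N)) hN] : \forall n \near \oo, qexp q (- A * q ^+ n) != 0.
  exact: (cvgn_neq0 c1 (oner_neq0 _)).
by rewrite (@qexp_iter q A N) // mulf_neq0 // qpoch_neq0.
Qed.

Lemma cvgn_bounded (s : nat -> C) (l : C) : s @ \oo --> l ->
  exists2 K, 0 < K & forall n, `|s n| <= K.
Proof.
move=> sl; have /cvg_seq_bounded [M [Mr Mu]] : cvgn s by apply/cvg_ex; exists l.
exists (`|M| + 1); first by rewrite ltr_wpDl.
move=> n; apply: (Mu (`|M| + 1)) => //.
by rewrite (le_lt_trans (real_ler_norm Mr)) // ltrDl.
Qed.

(** The bound has to be uniform in the shift k; it comes from the product with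
    |A| and |q| in place of A and q, whose factors are at least 1. *)
Lemma qpoch_bounded q A : q != 0 -> `|q| < 1 ->
  exists2 K, 0 < K & forall k m, `|qpoch (A * q ^+ k) q m| <= K.
Proof.
move=> q0 q1.
have nq0 : `|q| != 0 by rewrite normr_eq0.
have nq1 : `| `|q| | < 1 by rewrite normr_id.
have [K K0 hK] := cvgn_bounded (cvg_qpoch (A := - `|A|) nq0 nq1).
exists K => // k m; apply: le_trans (hK m).
rewrite /qpoch !normr_prod; apply: ler_prod => j _; rewrite normr_ge0 /=.
rewrite mulNr opprK [leRHS]ger0_norm ?addr_ge0 ?mulr_ge0 ?exprn_ge0 //.
apply: le_trans (ler_normB _ _) _; rewrite normr1 lerD2l !normrM !normrX.
rewrite -mulrA ler_wpM2l // -exprD.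
by rewrite exprD ler_piMl ?exprn_ge0 // exprn_ile1 // ltW.
Qed.

Lemma qpochV_bounded q : q != 0 -> `|q| < 1 ->
  exists2 K, 0 < K & forall n, `|(qpoch q q n)^-1| <= K.
Proof.
move=> q0 q1; apply: (@cvgn_bounded _ (qexp q (- q))^-1).
by apply: cvgV; [apply: qexp_neq0 | apply: cvg_qpoch].
Qed.

Lemma is_derive_qexp q t : `|q| < 1 ->
  is_derive (t : C) (1 : C) (qexp q) (psum (fun k => k.+1%:R * qexp_coef q k.+1) t).
Proof.
move=> q1; have -> : qexp q = psum (qexp_coef q) by apply/funext => x; exact: qexpE.
by apply: psum_derive; apply: pconv_qexp_coef.
Qed.

Lemma qexp'E q t : `|q| < 1 -> qexp' q t = psum (fun k => k.+1%:R * qexp_coef q k.+1) t.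
Proof.
move=> q1; have h := is_derive_qexp t q1.
by rewrite /qexp' derive1E; exact: derive_val.
Qed.

Lemma qexp'_series q t : `|q| < 1 ->
  (fun n => \sum_(1 <= k < n) q ^+ 'C(k, 2) / qpoch q q k * k%:R * t ^+ k.-1)
    @ \oo --> qexp' q t.
Proof.
move=> q1; rewrite qexp'E // -cvg_shiftS.
have [w tw gw] := pconv_qexp_coef t q1.
have w0 : w != 0 by rewrite gt_eqF // (le_lt_trans _ tw).
have h := geo_cvg (geo_radius (ltW tw) (geo_deriv w0 gw)).
have e : series (fun k => k.+1%:R * qexp_coef q k.+1 * t ^+ k) =
  [sequence \sum_(1 <= k < n.+1) q ^+ 'C(k, 2) / qpoch q q k * k%:R * t ^+ k.-1]_n.
  apply/funext => n; rewrite /= seriesE big_add1 big_mkord.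
  by apply: eq_bigr => k _; rewrite /qexp_coef /= [_%:R * _]mulrC.
by rewrite -e; exact: h.
Qed.

End QExponential.

(** * A three-term recurrence *)

Section Coefficients.
Variable R : realType.
Local Notation C := (Cplx R).
Variables (q a b z : C).
Hypotheses (q0 : q != 0) (a0 : a != 0) (b0 : b != 0) (z0 : z != 0).
Hypothesis q1 : forall n, 1 - q ^+ n.+1 != 0.
Implicit Types (n k m : nat).

Local Lemma qq_neq0 n : qpoch q q n != 0.
Proof. by apply/prodf_neq0 => i _; rewrite -exprS. Qed.

Definition acoef k := a ^+ k * qpoch (1 / (a * z)) q k * qpoch (z / a) q k / qpoch q q k.

Definition bcoef k m := b ^+ m * qpoch (q ^+ k / (a * b)) q m / qpoch q q m.

(** The numbers c_n, written as the defining sum of Q_n in base q; see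
    [ASC_ccoef]. *)
Definition ccoef n := \sum_(k < n.+1) acoef k * bcoef k (n - k).

Lemma acoefS k : acoef k.+1 =
  acoef k * (a - q ^+ k * (z + z^-1) + q ^+ k ^+ 2 / a) / (1 - q ^+ k.+1).
Proof.
rewrite /acoef !qpochS -exprS [a ^+ _.+1]exprS.
have h1 := q1 k; have h2 := qq_neq0 k.
by field; rewrite z0 a0 h1 h2.
Qed.

Lemma bcoefS k m : bcoef k m.+1 = bcoef k m * (b - q ^+ (k + m) / a) / (1 - q ^+ m.+1).
Proof.
rewrite /bcoef !qpochS -exprS [b ^+ _.+1]exprS exprD.
have h1 := q1 m; have h2 := qq_neq0 m.
by field; rewrite b0 a0 h1 h2.
Qed.

Lemma bcoefSl k m : bcoef k m.+1 = (b - q ^+ k / a) * bcoef k.+1 m / (1 - q ^+ m.+1).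
Proof.
rewrite /bcoef (qpochSl _ _ m) (qpochS q) -exprS [b ^+ _.+1]exprS.
have h1 := q1 m; have h2 := qq_neq0 m.
have -> : q ^+ k / (a * b) * q = q ^+ k.+1 / (a * b) by rewrite exprSr mulrAC.
by field; rewrite b0 a0 h1 h2.
Qed.

(** The certificate of the telescoping in [ccoef_telescope].  Its second part
    comes from splitting 1 - q^(n+2) as
    (1 - q^(n+2-k)) + q^(n+2-k) (1 - q^k), that is from Pascal's rule for
    q-binomial coefficients, its first part from what remains. *)
Let G n k := q ^+ n.+1 / a * (1 - q ^+ k) * acoef k * bcoef k (n.+1 - k)
  - q ^+ (n.+2 - k) * (1 - q ^+ k) * acoef k * bcoef k (n.+2 - k).

(** Summed over k <= n, the right-hand side collapses to G n n.+1, and this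
    cancels the terms k = n + 1 and k = n + 2 of the recurrence. *)
Lemma ccoef_telescope n k : (k <= n)%N ->
  (1 - q ^+ n.+2) * (acoef k * bcoef k (n.+2 - k))
  - (a + b - q ^+ n.+1 * (z + z^-1)) * (acoef k * bcoef k (n.+1 - k))
  + (a * b - q ^+ n) * (acoef k * bcoef k (n - k)) = G n k.+1 - G n k.
Proof.
move=> kn; rewrite /G !subSS !subSn ?(leqW kn) //.
have nE : n = (k + (n - k))%N by rewrite subnKC.
move: (n - k)%N nE => m ->.
set s := z + z^-1.
have e0 : (a * b - q ^+ (k + m)) * (acoef k * bcoef k m) =
   a * (1 - q ^+ m.+1) * (acoef k * bcoef k m.+1).
  by rewrite bcoefS; have h := q1 m; field; rewrite h a0.
rewrite e0 (bcoefS k m.+1) (bcoefSl k m) (bcoefS k.+1 m) acoefS -/s.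
have h1 := q1 m; have h2 := q1 m.+1; have h3 := q1 k.
rewrite addSn addnS !exprS exprD; rewrite !exprS in h1 h2 h3.
move: (acoef k) (bcoef k.+1 m) (q ^+ k) (q ^+ m) h1 h2 h3 => A B P M h1 h2 h3.
by field; rewrite h1 h2 h3 a0.
Qed.

Lemma ccoef_rec n : (1 - q ^+ n.+2) * ccoef n.+2 =
  (a + b - q ^+ n.+1 * (z + z^-1)) * ccoef n.+1 - (a * b - q ^+ n) * ccoef n.
Proof.
have st : \sum_(k < n.+1) (G n k.+1 - G n k) = G n n.+1.
  rewrite -(big_mkord xpredT (fun k => G n k.+1 - G n k)) telescope_sumr //.
  by rewrite /G expr0 subrr !(mulr0, mul0r) !subr0.
have sE : \sum_(k < n.+1) (G n k.+1 - G n k) =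
  (1 - q ^+ n.+2) * (\sum_(k < n.+1) acoef k * bcoef k (n.+2 - k))
  - (a + b - q ^+ n.+1 * (z + z^-1)) * (\sum_(k < n.+1) acoef k * bcoef k (n.+1 - k))
  + (a * b - q ^+ n) * ccoef n.
  rewrite /ccoef !mulr_sumr -sumrB -big_split /=; apply: eq_bigr => k _.
  by rewrite ccoef_telescope // -ltnS.
rewrite st in sE.
have c1E : ccoef n.+1 =
    \sum_(k < n.+1) acoef k * bcoef k (n.+1 - k) + acoef n.+1 * bcoef n.+1 0.
  by rewrite /ccoef big_ord_recr /= subnn.
have c2E : ccoef n.+2 =
    \sum_(k < n.+1) acoef k * bcoef k (n.+2 - k)
    + acoef n.+1 * bcoef n.+1 1 + acoef n.+2 * bcoef n.+2 0.
  by rewrite /ccoef 2!big_ord_recr /= subnn subSnn.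
rewrite c1E c2E.
move: sE; rewrite /G subnn subSnn.
have b00 k : bcoef k 0 = 1 by rewrite /bcoef expr0 /qpoch !big_ord0 mulr1 divr1.
rewrite (bcoefS _ 0) !b00 (acoefS n.+1) addn0.
have h1 := q1 0; have h2 := q1 n.+1.
rewrite [q ^+ n.+2]exprS in h2 *.
move: (\sum_(k < n.+1) _) (\sum_(k < n.+1) _) => Y X.
move: (ccoef n) (acoef n.+1) (q ^+ n.+1) (q ^+ n) h2 => c A P N h2 sE.
(* Solve the collapsed sum for the term in c_n, so that the powers of q of
   degree n disappear from the identity that is left. *)
have cE : (a * b - N) * c = P / a * (1 - P) * A * 1
    - q ^+ 1 * (1 - P) * A * (1 * (b - P / a) / (1 - q ^+ 1))
    - ((1 - q * P) * X - (a + b - P * (z + z^-1)) * Y).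
  by rewrite sE; ring.
rewrite cE; rewrite !expr1 in h1 *.
by field; rewrite h1 h2 a0 z0.
Qed.

(** The recurrence read as the functional equation
    (1 - au)(1 - bu) F(u) = (1 - zu)(1 - u/z) F(qu). *)
Lemma ccoef_quadmul : quadmul (a + b) (a * b) ccoef =
  quadmul (z + z^-1) 1 (fun k => q ^+ k * ccoef k).
Proof.
apply/funext => -[|[|n]]; rewrite /quadmul /=.
- by rewrite !mulr0 expr0 mul1r.
- rewrite /ccoef !big_ord_recr !big_ord0 /= !add0r subnn subSnn.
  rewrite !expr0 /= !mul1r !mulr0 !addr0 bcoefS acoefS addn0.
  have h1 := q1 0; rewrite /acoef /bcoef /qpoch !big_ord0 expr0 expr1 /=.
  by rewrite expr1 in h1; field; rewrite h1 a0 z0.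
- have := ccoef_rec n => e; apply/eqP; rewrite -subr_eq0; apply/eqP.
  have {1}-> : ccoef n.+2 = (1 - q ^+ n.+2) * ccoef n.+2 + q ^+ n.+2 * ccoef n.+2 by ring.
  by rewrite e; ring.
Qed.

(** Factor by factor, 1 - A q^(-j) = - A q^(-j) (1 - A^(-1) q^j). *)
Lemma qpoch_inv A k : A != 0 ->
  qpoch A q^-1 k = (- A) ^+ k * q ^- 'C(k, 2) * qpoch A^-1 q k.
Proof.
move=> A0; elim: k => [|k IH].
  by rewrite /qpoch !big_ord0 expr0 bin0n /= expr0 invr1 !mulr1.
rewrite !qpochS IH binS bin1 exprD exprS exprVn.
have h1 : q ^+ k != 0 by rewrite expf_neq0.
have h2 : q ^+ 'C(k, 2) != 0 by rewrite expf_neq0.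
by field; rewrite h1 h2 A0.
Qed.

Lemma qpoch_falling n k : (k <= n)%N ->
  qpoch (q ^+ n) q^-1 k = qpoch q q n / qpoch q q (n - k).
Proof.
elim: k => [|k IH] kn.
  by rewrite subn0 divff ?qq_neq0 // /qpoch big_ord0.
rewrite qpochS (IH (ltnW kn)) -(subnSK kn) qpochS -exprS subnSK //.
have -> : q ^+ n * q^-1 ^+ k = q ^+ (n - k).
  by rewrite exprVn -{1}(subnK (ltnW kn)) exprD mulfK // expf_neq0.
have h1 := qq_neq0 (n - k.+1).
have h2 : 1 - q ^+ (n - k) != 0 by rewrite -(subnSK kn).
by field; rewrite h1 h2.
Qed.

Lemma bin2_addn k m : 'C(k + m, 2) = ('C(k, 2) + k * m + 'C(m, 2))%N.
Proof.
elim: m => [|m IH]; first by rewrite addn0 muln0 bin0n !addn0.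
by rewrite addnS binS bin1 IH [in RHS]binS bin1 mulnS; ring.
Qed.

(** Each factorial of base 1/q is turned around by [qpoch_inv]; the powers of q
    add up to C(n, 2) by [bin2_addn]. *)
Lemma ASC_ccoef n :
  ASC_z n z a b q^-1 = (- 1) ^+ n * q ^- 'C(n, 2) * qpoch q q n * ccoef n.
Proof.
rewrite /ASC_z /ccoef !mulr_sumr; apply: eq_bigr => -[k /= kn] _.
rewrite ltnS in kn.
have -> : q^-1 ^- n = q ^+ n by rewrite exprVn invrK.
rewrite qpoch_falling //.
move: (subnKC kn); move: (n - k)%N => m <- {n kn}.
have qk : q ^+ k != 0 by rewrite expf_neq0.
rewrite (@qpoch_inv (a * z)) ?mulf_neq0 //.
rewrite (@qpoch_inv (a * z^-1)) ?mulf_neq0 ?invr_neq0 //.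
rewrite (@qpoch_inv (a * b * q^-1 ^+ k)) ?mulf_neq0 ?expf_neq0 ?invr_neq0 //.
rewrite (@qpoch_inv q^-1) ?invr_neq0 // invrK.
have -> : (a * z^-1)^-1 = z / a by rewrite invfM invrK mulrC.
have -> : (a * b * q^-1 ^+ k)^-1 = q ^+ k / (a * b).
  by rewrite invfM exprVn invrK mulrC.
rewrite /acoef /bcoef div1r bin2_addn !exprD exprM.
rewrite (exprNn (a * z)) (exprNn (a / z)) (exprNn q^-1).
rewrite (exprNn (a * b * q^-1 ^+ k)) !exprMn !exprVn.
have nz1 := qq_neq0 k; have nz2 := qq_neq0 m.
have nz3 : q ^+ 'C(k, 2) != 0 by rewrite expf_neq0.
have nz4 : q ^+ 'C(m, 2) != 0 by rewrite expf_neq0.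
have nz5 : (q ^+ k) ^+ m != 0 by rewrite expf_neq0.
have nz6 : a ^+ k != 0 by rewrite expf_neq0.
have nz7 : a ^+ m != 0 by rewrite expf_neq0.
have nz8 : z ^+ k != 0 by rewrite expf_neq0.
have nz9 : (-1) ^+ k != 0 :> C by rewrite signr_eq0.
move: ((q ^+ k) ^+ m) (q ^+ 'C(k, 2)) (q ^+ 'C(m, 2)) ((-1) ^+ k) ((-1) ^+ m)
  (qpoch q q k) (qpoch q q m) nz1 nz2 nz3 nz4 nz5 nz9.
move: (qpoch q q (k + m)) (qpoch _ q k) (qpoch _ q k) (qpoch _ q m).
move: (q ^+ k) (a ^+ k) (a ^+ m) (z ^+ k) (b ^+ m) qk nz6 nz7 nz8.
move=> qk ak am zk bm h1 h2 h3 h4 v1 v2 v3 v4 v5 v6 v7 v8 v9 v10 v11.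
move=> h5 h6 h7 h8 h9 h10.
by field; rewrite h1 h2 h3 h4 h5 h6 h7 h8 h9 h10.
Qed.

End Coefficients.

(** * The product formula for the generating function *)

Section ProductFormula.
Variable R : realType.
Local Notation C := (Cplx R).
Variables (q a b z M : C).
Hypotheses (q0 : q != 0) (q1 : `|q| < 1).
Hypotheses (a0 : a != 0) (b0 : b != 0) (z0 : z != 0).
Hypotheses (M0 : 0 < M) (aM : `|a| <= M) (bM : `|b| <= M).
Implicit Types (n k m : nat) (u w : C).

Local Notation c := (ccoef q a b z).

(** After a^k b^(n-k) has been taken out, each term is a product of factorials
    that are bounded because the infinite products converge; there are n + 1
    terms. *)
Lemma ccoef_bound : exists2 K : C, 0 < K &
  forall n, `|c n| <= K * (n.+1%:R * M ^+ n).
Proof.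
have [K1 K10 h1] := qpoch_bounded (1 / (a * z)) q0 q1.
have [K2 K20 h2] := qpoch_bounded (z / a) q0 q1.
have [K3 K30 h3] := qpoch_bounded (1 / (a * b)) q0 q1.
have [V V0 hV] := qpochV_bounded q0 q1.
have M0' := ltW M0.
have ha k : `|acoef q a z k| <= K1 * K2 * V * M ^+ k.
  rewrite /acoef !normrM normrX.
  have := h1 0%N k; have := h2 0%N k; rewrite expr0 !mulr1 => h2k h1k.
  have -> : K1 * K2 * V * M ^+ k = M ^+ k * K1 * K2 * V by ring.
  by rewrite !ler_pM // ?mulr_ge0 ?exprn_ge0 // lerXn2r ?nnegrE.
have hb k m : `|bcoef q a b k m| <= K3 * V * M ^+ m.
  rewrite /bcoef !normrM normrX.
  have := h3 k m; rewrite mulrAC mul1r => h3k.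
  have -> : K3 * V * M ^+ m = M ^+ m * K3 * V by ring.
  by rewrite !ler_pM // ?mulr_ge0 ?exprn_ge0 // lerXn2r ?nnegrE.
exists (K1 * K2 * V * (K3 * V)); first by rewrite !mulr_gt0.
move=> n; rewrite /ccoef; apply: le_trans (ler_norm_sum _ _ _) _.
apply: (@le_trans _ _ (\sum_(k < n.+1) K1 * K2 * V * (K3 * V) * M ^+ n)).
  apply: ler_sum => -[k /= kn] _; rewrite ltnS in kn.
  rewrite normrM -{2}(subnKC kn) exprD mulrACA; apply: ler_pM => //.
by rewrite sumr_const card_ord -[leLHS]mulr_natl mulrCA.
Qed.

Lemma pconv_ccoef u : `|u| * M < 1 -> pconv c u.
Proof.
move=> uM; have [K K0 hK] := ccoef_bound.
have uM' : `|u| < M^-1 by rewrite -[M^-1]mul1r ltr_pdivlMr.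
have [w1 w2] := midf_lt uM'; set w := _ / 2 in w1 w2.
exists w => //.
have w0 : 0 <= w by rewrite ltW // (le_lt_trans _ w1).
have g : geo (fun k => (w * M) ^+ k).
  apply: geo_expr; rewrite (ger0_norm (mulr_ge0 w0 (ltW M0))).
  by rewrite -ltr_pdivlMr // div1r.
apply: (geo_le (K := K)) (geoD (geo_muln g) g) _ => k.
have -> : k%:R * (w * M) ^+ k + (w * M) ^+ k = k.+1%:R * M ^+ k * w ^+ k.
  by rewrite -[k.+1%:R]natr1 exprMn; ring.
rewrite normrM [X in _ <= K * X]normrM mulrA ler_wpM2r //.
by rewrite [X in _ <= K * X]ger0_norm // mulr_ge0 // exprn_ge0 // ltW.
Qed.

Let q1' n : 1 - q ^+ n.+1 != 0 := subr1X_neq0 n q1.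

Lemma psum_ccoef_fun u : `|u| * M < 1 ->
  (1 - a * u) * (1 - b * u) * psum c u =
  (1 - z * u) * (1 - u / z) * psum c (u * q).
Proof.
move=> uM; have pc := pconv_ccoef uM.
have gq : geo (fun k => q ^+ k * c k * u ^+ k).
  apply: (geo_le (K := 1)) (pconv_geo pc) _ => k.
  have qk : `|q ^+ k| <= 1 by exact: normX_le1 q1.
  by rewrite mul1r -mulrA normrM ler_piMl.
have := psum_quadmul (a + b) (a * b) (pconv_geo pc).
rewrite (ccoef_quadmul a0 b0 z0 q1') (psum_quadmul _ _ gq) psum_scale mulrC => e.
have -> : (1 - a * u) * (1 - b * u) * psum c u =
   (1 - (a + b) * u + a * b * u ^+ 2) * psum c u by ring.
rewrite -e [u * q]mulrC mulrC; congr (_ * _).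
by field.
Qed.

(** The point u q^j stays in the disc |u| M < 1, so the functional equation can
    be used repeatedly. *)
Lemma psum_ccoef_iter u n : `|u| * M < 1 ->
  qpoch (a * u) q n * qpoch (b * u) q n * psum c u =
  qpoch (z * u) q n * qpoch (u / z) q n * psum c (u * q ^+ n).
Proof.
move=> uM; elim: n => [|n IH].
  by rewrite !qpoch0 expr0 !mulr1.
have uM' : `|u * q ^+ n| * M < 1.
  have qn : `|q ^+ n| <= 1 by exact: normX_le1 q1.
  apply: le_lt_trans uM; apply: ler_wpM2r; first exact: ltW.
  by rewrite normrM; apply: ler_piMr.
have e := psum_ccoef_fun uM'.
rewrite !qpochS exprSr !mulrA.
have -> : qpoch (a * u) q n * (1 - a * u * q ^+ n) * qpoch (b * u) q n *
    (1 - b * u * q ^+ n) * psum c u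
  = (1 - a * u * q ^+ n) * (1 - b * u * q ^+ n) *
    (qpoch (a * u) q n * qpoch (b * u) q n * psum c u) by ring.
rewrite IH.
have -> : (1 - a * u * q ^+ n) * (1 - b * u * q ^+ n) *
   (qpoch (z * u) q n * qpoch (u / z) q n * psum c (u * q ^+ n))
  = qpoch (z * u) q n * qpoch (u / z) q n *
   ((1 - a * (u * q ^+ n)) * (1 - b * (u * q ^+ n)) * psum c (u * q ^+ n)) by ring.
rewrite e; ring.
Qed.

Lemma ccoef0 : c 0 = 1.
Proof.
rewrite /ccoef big_ord_recr big_ord0 /= add0r /acoef /bcoef.
by rewrite !expr0 !qpoch0 !mulr1 divr1 mulr1.
Qed.

(** The product formula for F, freed of denominators: the limit of
    [psum_ccoef_iter], where F(u q^n) tends to c_0 = 1. *)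
Lemma psum_ccoefE u : `|u| * M < 1 ->
  qexp q (- (a * u)) * qexp q (- (b * u)) * psum c u =
  qexp q (- (z * u)) * qexp q (- (u / z)).
Proof.
move=> uM.
have l := cvgnM (cvgnM (cvg_qpoch (A := a * u) q0 q1) (cvg_qpoch (A := b * u) q0 q1))
  (cvgn_cst (x := psum c u)).
have r := cvgnM (cvgnM (cvg_qpoch (A := z * u) q0 q1) (cvg_qpoch (A := u / z) q0 q1))
  (pconv_cvg0 u q1 (pconv_ccoef (u := 0) _)).
have u0 : `|0 : C| * M < 1 by rewrite normr0 mul0r.
have {}r := r u0; rewrite ccoef0 mulr1 in r.
have e : (fun n => qpoch (a * u) q n * qpoch (b * u) q n * psum c u) =
    (fun n => qpoch (z * u) q n * qpoch (u / z) q n * psum c (u * q ^+ n)).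
  by apply/funext => n; exact: psum_ccoef_iter.
by rewrite e in l; exact: limn_unique l r.
Qed.

(** Coefficients of H, the function F without its two dominant poles. *)
Definition hcoef := quadmul (a + b) (a * b) c.

(** H(u) is a polynomial multiple of F(qu), so its disc of convergence is larger
    by the factor 1/|q|. *)
Lemma pconv_hcoef u : `|q * u| * M < 1 -> pconv hcoef u.
Proof.
move=> uM; rewrite /hcoef (ccoef_quadmul a0 b0 z0 q1').
by apply/pconv_quadmul/pconv_scale => //; apply: pconv_ccoef.
Qed.

(** The product formula for H: the factors 1 - au and 1 - bu of the two infinite
    products have been cancelled. *)
Lemma psum_hcoefE u : `|q * u| * M < 1 ->
  psum hcoef u * (qexp q (- (a * q * u)) * qexp q (- (b * q * u))) =
  qexp q (- (z * u)) * qexp q (- (u / z)).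
Proof.
move=> uM; rewrite /hcoef (ccoef_quadmul a0 b0 z0 q1').
have pc := pconv_scale q0 (pconv_ccoef uM).
rewrite (psum_quadmul _ _ (pconv_geo pc)) psum_scale.
rewrite (qexp_fun (- (z * u)) q0 q1) (qexp_fun (- (u / z)) q0 q1).
have e := psum_ccoefE uM.
have ea : - (a * q * u) = - (a * (q * u)) by ring.
have eb : - (b * q * u) = - (b * (q * u)) by ring.
have ez : q * - (z * u) = - (z * (q * u)) by ring.
have ez' : q * - (u / z) = - (q * u / z) by ring.
rewrite ea eb ez ez'.
move: (psum c _) (qexp q _) (qexp q _) (qexp q _) (qexp q _) e => F Y X B A e.
have -> : (1 - (z + z^-1) * u + 1 * u ^+ 2) * F * (A * B) =
  (1 - (z + z^-1) * u + 1 * u ^+ 2) * (A * B * F) by ring.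
by rewrite e; field.
Qed.

End ProductFormula.

(** * Contribution of the poles *)

Section Poles.
Variable R : realType.
Local Notation C := (Cplx R).
Implicit Types (f g h e : nat -> C) (A B u w K M : C) (n k m : nat).

(** The sequence e consists of the coefficients of 1 / (1 - A u + B u^2), so this
    is division of power series. *)
Lemma quadmul_inv A B f e : e 0%N = 1 -> e 1%N = A ->
  (forall n, e n.+2 = A * e n.+1 - B * e n) ->
  forall n, f n = \sum_(k < n.+1) quadmul A B f k * e (n - k)%N.
Proof.
move=> e0 e1 eS n; suff [] : f n = \sum_(k < n.+1) quadmul A B f k * e (n - k)%N /\
   f n.+1 = \sum_(k < n.+2) quadmul A B f k * e (n.+1 - k)%N by [].
elim: n => [|n [IH0 IH1]].
  rewrite !big_ord_recr !big_ord0 /= !add0r ?subnn ?subn0 e0 e1 /quadmul /=; split; ring.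
split=> //; rewrite 2!big_ord_recr /= subnn subSnn e0 e1.
rewrite big_ord_recr /= subnn e0 in IH1.
have -> : \sum_(k < n.+1) quadmul A B f k * e (n.+2 - k)%N =
   A * (\sum_(k < n.+1) quadmul A B f k * e (n.+1 - k)%N)
   - B * (\sum_(k < n.+1) quadmul A B f k * e (n - k)%N).
  rewrite !mulr_sumr -sumrB; apply: eq_bigr => -[k /= kn] _.
  by rewrite ltnS in kn; rewrite !subSn ?(leqW kn) // eS; ring.
rewrite -IH0.
move/eqP: IH1; rewrite -subr_eq => /eqP <-.
by rewrite /quadmul /=; ring.
Qed.

Lemma geo_common f g : geo f -> geo g -> exists K r : C,
  [/\ 0 < K, 0 < r, r < 1, forall n, `|f n| <= K * r ^+ n
    & forall n, `|g n| <= K * r ^+ n].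
Proof.
move=> gf gg.
have gf' : geo (fun n => `|f n|).
  by apply: (geo_le (K := 1)) gf _ => n; rewrite normr_id mul1r.
have gg' : geo (fun n => `|g n|).
  by apply: (geo_le (K := 1)) gg _ => n; rewrite normr_id mul1r.
have [K [r [K0 r0 r1 hK]]] := geoD gf' gg'.
exists K, r; split => // n; apply: le_trans (hK n);
  by rewrite [leRHS]ger0_norm ?addr_ge0 // ?lerDl ?lerDr.
Qed.

Lemma geo_conv f g : geo f -> geo g ->
  geo (fun n => \sum_(k < n.+1) f k * g (n - k)%N).
Proof.
move=> gf gg; have [K [r [K0 r0 r1 hf hg]]] := geo_common gf gg.
have gr : geo (fun k => r ^+ k) by apply: geo_expr; rewrite gtr0_norm.
apply: (geo_le (K := K * K)) (geoD (geo_muln gr) gr) _ => n.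
have -> : n%:R * r ^+ n + r ^+ n = n.+1%:R * r ^+ n by rewrite -[n.+1%:R]natr1; ring.
apply: le_trans (ler_norm_sum _ _ _) _.
apply: (@le_trans _ _ (\sum_(k < n.+1) K * K * r ^+ n)).
  apply: ler_sum => -[k /= kn] _; rewrite ltnS in kn.
  by rewrite normrM -{2}(subnKC kn) exprD mulrACA; apply: ler_pM.
rewrite sumr_const card_ord -[leLHS]mulr_natl mulrCA ger0_norm //.
by rewrite mulr_ge0 // exprn_ge0 // ltW.
Qed.

(** Coefficients of h(u) / (1 - wu). *)
Definition polesum h w n := \sum_(k < n.+1) h k * w ^+ (n - k).

Lemma polesumE h w n : w != 0 ->
  polesum h w n = w ^+ n * series (fun k => h k * w^-1 ^+ k) n.+1.
Proof.
move=> w0; rewrite /polesum seriesE mulr_sumr; apply: eq_bigr => -[k /= kn] _.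
rewrite ltnS in kn; rewrite -{2}(subnK kn) exprD exprVn.
by have nz : w ^+ k != 0 by [rewrite expf_neq0]; field.
Qed.

Lemma normX_div_le w M n : `|w| <= M -> 0 < M -> `|w ^+ n / M ^+ n| <= 1.
Proof.
move=> wM M0; rewrite -expr_div_n normrX exprn_ile1 //.
by rewrite normrM normfV (gtr0_norm M0) ler_pdivrMr // mul1r.
Qed.

(** The difference is w^n times a tail of the series h(1/w). *)
Lemma pole_on h w M : 0 < M -> `|w| = M -> pconv h w^-1 ->
  geo (fun n => (polesum h w n - w ^+ n * psum h w^-1) / M ^+ n).
Proof.
move=> M0 wM ph; have w0 : w != 0 by rewrite -normr_gt0 wM.
have g := geo_shift (geo_tail_geo (pconv_geo ph)).
have wM' : `|w| <= M by rewrite wM.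
apply: geo_ext (geo_mull (K := 1) (f := fun n => - (w ^+ n / M ^+ n)) _ g) => n.
  by rewrite polesumE // /psum; ring.
by rewrite normrN normX_div_le.
Qed.

(** Divided by M^n, the sum is the convolution of h_k M^(-k) and (w/M)^k. *)
Lemma pole_in h w M : 0 < M -> `|w| < M -> pconv h M^-1 ->
  geo (fun n => polesum h w n / M ^+ n).
Proof.
move=> M0 wM ph.
have g : geo (fun k => (w / M) ^+ k).
  by apply: geo_expr; rewrite normrM normfV (gtr0_norm M0) ltr_pdivrMr // mul1r.
apply: geo_ext (geo_conv (pconv_geo ph) g) => n.
rewrite /polesum mulr_suml; apply: eq_bigr => -[k /= kn] _; rewrite ltnS in kn.
rewrite -{2}(subnKC kn) exprD expr_div_n exprVn invfM.
by ring.
Qed.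

(** Here h is divided by (1 - wu)^2.  Writing n - k + 1 = (n + 1) - k gives
    n + 1 times a tail of h(1/w), and a tail of the series with terms k h_k w^(-k),
    which is h'(1/w) / w. *)
Lemma pole_double h w M : 0 < M -> `|w| = M -> pconv h w^-1 ->
  geo (fun n => (\sum_(k < n.+1) h k * ((n - k).+1%:R * w ^+ (n - k))
    - w ^+ n * (n.+1%:R * psum h w^-1
        - w^-1 * psum (fun k => k.+1%:R * h k.+1) w^-1)) / M ^+ n).
Proof.
move=> M0 wM ph; have w0 : w != 0 by rewrite -normr_gt0 wM.
have wM' : `|w| <= M by rewrite wM.
have gh := pconv_geo ph.
have gk := geo_muln gh.
have gS := geo_shift (geo_tail_geo gh).
have gT := geo_shift (geo_tail_geo gk).
have TE : w^-1 * psum (fun k => k.+1%:R * h k.+1) w^-1 =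
   limn (series (fun k => k%:R * (h k * w^-1 ^+ k))).
  rewrite (geo_limS gk) mul0r add0r /psum -geo_limZ; last first.
    apply: geo_ext (geoZ w (geo_shift gk)) => k.
    by rewrite exprS; move: (w^-1 ^+ k) => W; field.
  congr (limn (series _)); apply/funext => k; rewrite exprS; ring.
have e n : (\sum_(k < n.+1) h k * ((n - k).+1%:R * w ^+ (n - k))) =
   w ^+ n * (n.+1%:R * series (fun k => h k * w^-1 ^+ k) n.+1
     - series (fun k => k%:R * (h k * w^-1 ^+ k)) n.+1).
  rewrite !seriesE mulrBr !mulr_sumr -sumrB; apply: eq_bigr => -[k /= kn] _.
  rewrite ltnS in kn; rewrite -subSn // natrB ?(leqW kn) //.
  have -> : w ^+ n = w ^+ (n - k) * w ^+ k by rewrite -exprD subnK.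
  have nz : w ^+ k != 0 by rewrite expf_neq0.
  by rewrite exprVn; field.
have g : geo (fun n => n.+1%:R * (limn (series (fun k => h k * w^-1 ^+ k))
     - series (fun k => h k * w^-1 ^+ k) n.+1)).
  by apply: geo_ext (geoD (geo_muln gS) gS) => n; rewrite -[n.+1%:R]natr1 mulrDl mul1r.
apply: geo_ext (geo_mull (K := 1) (f := fun n => w ^+ n / M ^+ n) _ (geoB gT g)) => n.
  by rewrite e TE /psum; ring.
exact: normX_div_le.
Qed.

End Poles.

(** * The leading terms *)

Section Derivatives.
Variable R : realType.
Local Notation C := (Cplx R).
Implicit Types (f g : C -> C) (q u w t D r : C).

(** Derivatives are local; the product formula for H only holds in a disc. *)
Lemma is_derive_local f g u D r : 0 < r ->
  (forall x, `|x - u| <= r -> f x = g x) ->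
  is_derive (u : C) (1 : C) f D -> is_derive (u : C) (1 : C) g D.
Proof.
move=> r0 fg df.
have fu : f u = g u by apply: fg; rewrite subrr normr0 ltW.
have cf : (fun h : C => h^-1 *: ((f \o shift u) (h *: (1 : C)) - f u)) @ 0^' --> (D : C).
  have -> : D = 'D_1 f u by rewrite derive_val.
  exact: ex_derive.
have cg : (fun h : C => h^-1 *: ((g \o shift u) (h *: (1 : C)) - g u)) @ 0^' --> (D : C).
  apply: cvg_trans cf; apply: near_eq_cvg; near=> h.
  have hr : `|h| <= r by near: h; exact: dnbhs0_le.
  rewrite -fu /=; congr (_ *: (_ - _)); apply: fg.
  by rewrite addrK [h *: _]mulr1.
apply: (@DeriveDef _ _ _ u 1 g D).
  by apply: cvgP; exact: cg.
by rewrite /derive; exact: (@cvg_lim C (@norm_hausdorff C C) _ _ _ _ _ cg).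
Unshelve. all: by end_near. Qed.

Lemma is_derive_unique f u D D' : is_derive (u : C) (1 : C) f D ->
  is_derive (u : C) (1 : C) f D' -> D = D'.
Proof.
by move=> h h'; rewrite -(@derive_val _ _ _ _ _ _ _ h) -(@derive_val _ _ _ _ _ _ _ h').
Qed.

Lemma is_derive_qexpM q t u : `|q| < 1 -> t != 0 ->
  is_derive (u : C) (1 : C) (fun x : C => qexp q (t * x)) (t * qexp' q (t * u)).
Proof.
move=> q1 t0.
have -> : (fun x : C => qexp q (t * x)) = psum (fun k => t ^+ k * qexp_coef q k).
  by apply/funext => x; rewrite qexpE psum_scale.
have -> : t * qexp' q (t * u) =
      psum (fun k => k.+1%:R * (t ^+ k.+1 * qexp_coef q k.+1)) u.
  rewrite qexp'E // -psum_scale -psumZ.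
    by apply: psum_ext => k; rewrite exprS; ring.
  have [w tw gw] := pconv_qexp_coef (t * u) q1.
  have w0 : w != 0 by rewrite gt_eqF // (le_lt_trans _ tw).
  have := geo_radius (ltW tw) (geo_deriv w0 gw) => gd.
  by apply: geo_ext gd => k; rewrite exprMn; ring.
by apply: psum_derive; apply: pconv_scale => //; apply: pconv_qexp_coef.
Qed.

End Derivatives.

Section Leading.
Variable R : realType.
Local Notation C := (Cplx R).
Variables (q z : C).
Hypotheses (q0 : q != 0) (q1 : `|q| < 1) (z0 : z != 0).
Implicit Types (a b M w : C) (n : nat).

(** The hypothesis on H is the product formula at 1/a.  The factor a / (a - b) is
    1 / (1 - b/a), the first factor of 1 / (b/a)_oo. *)
Lemma leadE a b (H : C) n : a != 0 -> a != b -> `|b| <= `|a| ->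
  H * (qexp q (- q) * qexp q (- (b * q / a))) =
    qexp q (- (z / a)) * qexp q (- (1 / (a * z))) ->
  lead z a b q n = (-1) ^+ n * qexp q (- q) * (a / (a - b) * (a ^+ n * H)).
Proof.
move=> a0 ab ba e.
have nz : qexp q (- (b * q / a)) != 0.
  apply: qexp_neq0 => //; rewrite !normrM normfV mulrAC.
  apply: le_lt_trans q1; apply: ler_piMl => //.
  by rewrite ler_pdivrMr ?normr_gt0 // mul1r.
rewrite /lead !(qpochinfE _ q0 q1) -e (qexp_fun (- (b / a)) q0 q1).
have -> : q * - (b / a) = - (b * q / a) by ring.
have ab' : a - b != 0 by rewrite subr_eq0.
rewrite (exprNn a); move: (qexp q (- q)) (qexp q (- (b * q / a))) nz => E F nz.
by field; rewrite ab' a0 nz.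
Qed.

(** Logarithmic derivative at 1/a of H(u) E(-aqu)^2 = E(-zu) E(-u/z), the product
    formula for H in the case a = b. *)
Lemma lambdaE a M (c := ccoef q a a z) (h := hcoef q a a z) :
  0 < M -> `|a| = M ->
  qpochinf (z / a) q != 0 -> qpochinf (1 / (a * z)) q != 0 ->
  lambda z a q * psum h a^-1 = - (a^-1 * psum (fun k => k.+1%:R * h k.+1) a^-1).
Proof.
move=> M0 aM n1 n2.
have a0 : a != 0 by rewrite -normr_gt0 aM.
have aM' : `|a| <= M by rewrite aM.
have nq : 0 < `|q| by rewrite normr_gt0.
have pE u : `|q * u| * M < 1 ->
   psum h u * (qexp q (- (a * q) * u) * qexp q (- (a * q) * u)) =
   qexp q (- z * u) * qexp q (- z^-1 * u).
  by move=> uM; have := psum_hcoefE q0 q1 a0 a0 z0 M0 aM' aM' uM;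
   rewrite ![- _ * u]mulNr [z^-1 * u]mulrC.
have qa : `|q * a^-1| * M = `|q|.
  by rewrite normrM normfV aM mulfVK // gt_eqF.
have dh : is_derive (a^-1 : C) (1 : C) (psum h) (psum (fun k => k.+1%:R * h k.+1) a^-1).
  apply: psum_derive; apply: (pconv_hcoef (M := M)) => //; by rewrite qa.
have aq0 : - (a * q) != 0 by rewrite oppr_eq0 mulf_neq0.
have nz0 : - z != 0 by rewrite oppr_eq0.
have nzi0 : - z^-1 != 0 by rewrite oppr_eq0 invr_neq0.
have d1 := is_derive_qexpM a^-1 q1 aq0.
have d2 := is_derive_qexpM a^-1 q1 nz0.
have d3 := is_derive_qexpM a^-1 q1 nzi0.
have dL := is_deriveM dh (is_deriveM d1 d1).
have dR := is_deriveM d2 d3.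
have r0 : 0 < (1 - `|q|) / (`|q| * M).
  by rewrite divr_gt0 ?subr_gt0 // mulr_gt0.
(* The product formula for H holds in the disc |q u| M < 1, which contains a
   neighbourhood of 1/a because |q / a| M = |q|. *)
have loc x : `|x - a^-1| <= (1 - `|q|) / (`|q| * M) / 2 -> `|q * x| * M < 1.
  move=> hx.
  have hx' : `|x - a^-1| < (1 - `|q|) / (`|q| * M).
    apply: le_lt_trans hx _; rewrite ltr_pdivrMr // ltr_pMr // ltr1n //.
  have : `|q * (x - a^-1)| * M < 1 - `|q|.
    by rewrite normrM mulrAC mulrC -ltr_pdivlMr // mulr_gt0.
  move=> h1; have -> : q * x = q * (x - a^-1) + q * a^-1 by ring.
  apply: le_lt_trans (ler_wpM2r (ltW M0) (ler_normD _ _)) _.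
  by rewrite mulrDl qa -ltrBrDr.
have r0' : 0 < (1 - `|q|) / (`|q| * M) / 2 by rewrite divr_gt0.
have dL' := is_derive_local r0' (fun x hx => pE x (loc x hx)) dL.
have dE : psum h a^-1 * (qexp q (- (a * q) / a) * (- (a * q) * qexp' q (- (a * q) / a)) +
      qexp q (- (a * q) / a) * (- (a * q) * qexp' q (- (a * q) / a)))
    + (qexp q (- (a * q) / a) * qexp q (- (a * q) / a))
      * psum (fun k => k.+1%:R * h k.+1) a^-1
    = qexp q (- z / a) * (- z^-1 * qexp' q (- z^-1 / a))
      + qexp q (- z^-1 / a) * (- z * qexp' q (- z / a)).
  exact: is_derive_unique dL' dR.
have e := pE a^-1; rewrite qa in e; have {}e := e q1.
rewrite /lambda.
rewrite (qpochinfE _ q0 q1) in n1; rewrite (qpochinfE _ q0 q1) in n2.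
rewrite !(qpochinfE _ q0 q1).
have E1 : - (a * q) / a = - q by field.
have E2 : - z / a = - (z / a) by ring.
have E3 : - z^-1 / a = - (1 / (a * z)) by field; rewrite a0 z0.
rewrite E1 E2 E3 in e dE.
have nq2 : qexp q (- q) != 0 by apply: qexp_neq0.
move: e dE n1 n2 nq2.
move: (qexp q (- q)) (qexp q (- (z / a))) (qexp q (- (1 / (a * z)))) => Eq Ez Ei.
move: (qexp' q (- q)) (qexp' q (- (z / a))) (qexp' q (- (1 / (a * z)))) => Dq Dz Di.
move: (psum h a^-1) (psum (fun k => k.+1%:R * h k.+1) a^-1) => H H' e dE n1 n2 nq2.
have HE : H = Ez * Ei / (Eq * Eq) by rewrite -e mulfK // mulf_neq0.
(* Both H and H' are determined by the values of E and E'. *)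
have H'E : H' = (Ez * (- z^-1 * Di) + Ei * (- z * Dz)
   - H * (Eq * (- (a * q) * Dq) + Eq * (- (a * q) * Dq))) / (Eq * Eq).
  by rewrite -dE addrAC subrr add0r mulrAC mulfV ?mul1r // mulf_neq0.
rewrite H'E HE.
by field; rewrite n1 n2 nq2 a0 z0.
Qed.

Variables (a b : C).
Hypotheses (a0 : a != 0) (b0 : b != 0).
Local Notation c := (ccoef q a b z).
Local Notation h := (hcoef q a b z).

(** Only the parameters w of maximal modulus contribute to the leading term. *)
Definition polepart w M n := if `|w| == M then w ^+ n * psum h w^-1 else 0.

Lemma pole_geo M w : 0 < M -> `|a| <= M -> `|b| <= M -> `|w| <= M ->
  geo (fun n => (polesum h w n - polepart w M n) / M ^+ n).
Proof.
move=> M0 aM bM wM; have M0' : M != 0 by rewrite gt_eqF.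
rewrite /polepart; case: eqP => [we|/eqP wne].
  apply: pole_on => //; apply: (pconv_hcoef (M := M)) => //.
  by rewrite normrM normfV we mulfVK.
have wl : `|w| < M by rewrite lt_neqAle wne.
apply: geo_ext (@pole_in _ h w M M0 wl _) => [n|]; first by rewrite subr0.
apply: (pconv_hcoef (M := M)) => //.
by rewrite normrM normfV (gtr0_norm M0) mulfVK.
Qed.

Lemma polepart_bounded M w : 0 < M -> `|w| <= M ->
  exists2 K, 0 <= K & forall n, `|polepart w M n / M ^+ n| <= K.
Proof.
move=> M0 wM; exists `|psum h w^-1| => // n.
rewrite /polepart; case: eqP => _; last by rewrite mul0r normr0.
by rewrite mulrAC normrM ler_piMl // normX_div_le.
Qed.

(** Partial fractions of 1 / ((1 - au)(1 - bu)). *)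
Lemma ccoef_poles n : a != b ->
  c n = a / (a - b) * polesum h a n + b / (b - a) * polesum h b n.
Proof.
move=> ab; have d1 : a - b != 0 by rewrite subr_eq0.
have d2 : b - a != 0 by rewrite subr_eq0 eq_sym.
rewrite (@quadmul_inv _ (a + b) (a * b) c
  (fun m => a / (a - b) * a ^+ m + b / (b - a) * b ^+ m)).
- rewrite /polesum !mulr_sumr -big_split; apply: eq_bigr => k _ /=.
  by rewrite /hcoef; ring.
- by rewrite !expr0; field; rewrite d1 d2.
- by rewrite !expr1; field; rewrite d1 d2.
- by move=> m; rewrite !exprS; ring.
Qed.

(** (q)_n is 1 minus a partial sum of the series with the terms
    (q)_k - (q)_(k+1) = (q)_k q^(k+1). *)
Lemma geo_qpoch : geo (fun n => qpoch q q n - qpochinf q q).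
Proof.
rewrite (qpochinfE _ q0 q1).
have [K K0 hK] := cvgn_bounded (cvg_qpoch (A := q) q0 q1).
have g : geo (fun n => qpoch q q n * (q * q ^+ n)).
  by apply: (geo_mull hK); apply: geoZ; apply: geo_expr.
have sE n : series (fun n => qpoch q q n * (q * q ^+ n)) n = 1 - qpoch q q n.
  rewrite seriesE; elim: n => [|n IH]; first by rewrite big_ord0 qpoch0 subrr.
  by rewrite big_ord_recr /= IH qpochS; ring.
have lE : limn (series (fun n => qpoch q q n * (q * q ^+ n))) = 1 - qexp q (- q).
  apply: limnE.
  have := cvgnD (cvgn_cst (x := 1 : C)) (cvgnZ (x := -1) (cvg_qpoch (A := q) q0 q1)).
  rewrite mulN1r (_ : (fun n => _) = series (fun n => qpoch q q n * (q * q ^+ n))) //.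
  by apply/funext => n; rewrite sE mulN1r.
apply: geo_ext (geo_tail_geo g) => n.
by rewrite lE sE; ring.
Qed.

(** The passage from (q)_n to (q)_oo multiplies L n by a sequence that decays
    geometrically, so that even a factor n + 1 in L n is harmless. *)
Lemma geo_main M (L T : nat -> C) K : 0 < M ->
  geo (fun n => (c n - L n) / M ^+ n) ->
  (forall n, `|L n / M ^+ n| <= K * n.+1%:R) ->
  (forall n, T n = (-1) ^+ n * qexp q (- q) * L n) ->
  geo (fun n => ((-1) ^+ n * qpoch q q n * c n - T n) / M ^+ n).
Proof.
move=> M0 gc LK TE.
have [K' K'0 hK'] := cvgn_bounded (cvg_qpoch (A := q) q0 q1).
have g1 : geo (fun n => (-1) ^+ n * qpoch q q n * ((c n - L n) / M ^+ n)).
  by apply: (geo_mull (K := K')) gc => n; rewrite normrM normrX normrN1 expr1n mul1r.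
have gq := geo_qpoch.
have g2 : geo (fun n => (-1) ^+ n * (L n / M ^+ n) * (qpoch q q n - qpochinf q q)).
  apply: (geo_le (K := K)) (geoD (geo_muln gq) gq) _ => n.
  have -> : n%:R * (qpoch q q n - qpochinf q q) + (qpoch q q n - qpochinf q q) =
    n.+1%:R * (qpoch q q n - qpochinf q q) by rewrite -[n.+1%:R]natr1; ring.
  rewrite !normrM normrX normrN1 expr1n mul1r normr_nat mulrA.
  by apply: ler_wpM2r => //; rewrite -normrM.
apply: geo_ext (geoD g1 g2) => n.
by rewrite TE (qpochinfE _ q0 q1); ring.
Qed.

End Leading.

(** * Distinct and coinciding poles *)

Lemma norm_lincomb_le (F : numFieldType) (x y p s m K L : F) :
  `|p / m| <= K -> `|s / m| <= L ->
  `|(x * p + y * s) / m| <= `|x| * K + `|y| * L.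
Proof.
move=> pK sL; rewrite mulrDl -!mulrA; apply: le_trans (ler_normD _ _) _.
by apply: lerD; rewrite normrM; apply: ler_wpM2l.
Qed.

Section Asymptotics.
Variable R : realType.
Local Notation C := (Cplx R).
Variables (q a b z : C).
Hypotheses (q0 : q != 0) (q1 : `|q| < 1).
Hypotheses (a0 : a != 0) (b0 : b != 0) (z0 : z != 0).
Implicit Types (M w : C) (n : nat).
Local Notation c := (ccoef q a b z).
Local Notation h := (hcoef q a b z).

Lemma psum_hcoef_inv M w : 0 < M -> `|a| <= M -> `|b| <= M -> `|w| = M ->
  psum h w^-1 * (qexp q (- (a * q / w)) * qexp q (- (b * q / w))) =
  qexp q (- (z / w)) * qexp q (- (1 / (w * z))).
Proof.
move=> M0 aM bM wM; have w0 : w != 0 by rewrite -normr_gt0 wM.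
have := psum_hcoefE q0 q1 a0 b0 z0 M0 aM bM (u := w^-1).
have -> : `|q * w^-1| * M = `|q| by rewrite normrM normfV wM mulfVK ?gt_eqF.
move=> /(_ q1) ->; congr (_ * qexp q (- _)).
by field; rewrite w0 z0.
Qed.

Lemma lead_polepart_l M n : 0 < M -> `|b| <= M -> `|a| = M -> a != b ->
  lead z a b q n = (-1) ^+ n * qexp q (- q) * (a / (a - b) * polepart q z a b a M n).
Proof.
move=> M0 bM aM ab; rewrite /polepart aM eqxx.
have aM' : `|a| <= M by rewrite aM.
have ba : `|b| <= `|a| by rewrite aM.
have e := psum_hcoef_inv M0 aM' bM aM.
have eq : a * q / a = q by field.
by rewrite eq in e; exact: leadE e.
Qed.

Lemma lead_polepart_r M n : 0 < M -> `|a| <= M -> `|b| = M -> a != b ->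
  lead z b a q n = (-1) ^+ n * qexp q (- q) * (b / (b - a) * polepart q z a b b M n).
Proof.
move=> M0 aM bM ab; rewrite /polepart bM eqxx.
have bM' : `|b| <= M by rewrite bM.
have ab' : `|a| <= `|b| by rewrite bM.
have ba : b != a by rewrite eq_sym.
have e := psum_hcoef_inv M0 aM bM' bM.
have eq : b * q / b = q by field.
rewrite eq in e; apply: (leadE q0 q1 n b0 ba ab').
have swap (P X Y Z : C) : P * (X * Y) = Z -> P * (Y * X) = Z.
  by rewrite [Y * X]mulrC.
exact: swap e.
Qed.

Lemma Tn_distinct M n : 0 < M -> `|a| <= M -> `|b| <= M ->
  `|a| = M \/ `|b| = M -> a != b ->
  Tn z a b q n = (-1) ^+ n * qexp q (- q) *
    (a / (a - b) * polepart q z a b a M n + b / (b - a) * polepart q z a b b M n).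
Proof.
move=> M0 aM bM abM ab; rewrite mulrDr /Tn.
have [lt_ab|lt_ba|e_ab] := real_ltgtP (normr_real a) (normr_real b).
- have bM' : `|b| = M.
    by case: abM => // aM'; move: bM; rewrite -aM' => /(lt_le_trans lt_ab); rewrite ltxx.
  have p0 : polepart q z a b a M n = 0 by rewrite /polepart ifF // lt_eqF // -bM'.
  rewrite (lead_polepart_r n M0 aM bM' ab) p0.
  by move: (polepart _ _ _ _ _ _ _) (qexp _ _) => P E; ring.
- have aM' : `|a| = M.
    by case: abM => // bM'; move: aM; rewrite -bM' => /(lt_le_trans lt_ba); rewrite ltxx.
  have p0 : polepart q z a b b M n = 0 by rewrite /polepart ifF // lt_eqF // -aM'.
  rewrite (lead_polepart_l n M0 bM aM' ab) p0.
  by move: (polepart _ _ _ _ _ _ _) (qexp _ _) => P E; ring.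
- have aM' : `|a| = M by case: abM => // <-.
  have bM' : `|b| = M by rewrite -e_ab.
  by rewrite ab (lead_polepart_l n M0 bM aM' ab) (lead_polepart_r n M0 aM bM' ab).
Qed.

Lemma Tn_geo_distinct M : 0 < M -> `|a| <= M -> `|b| <= M ->
  `|a| = M \/ `|b| = M -> a != b ->
  geo (fun n => ((-1) ^+ n * qpoch q q n * c n - Tn z a b q n) / M ^+ n).
Proof.
move=> M0 aM bM abM ab.
have [Ka Ka0 hKa] := polepart_bounded q z a b M0 aM.
have [Kb Kb0 hKb] := polepart_bounded q z a b M0 bM.
have ga := pole_geo q0 q1 z0 a0 b0 M0 aM bM aM.
have gb := pole_geo q0 q1 z0 a0 b0 M0 aM bM bM.
apply: (geo_main q0 q1 M0 (K := `|a / (a - b)| * Ka + `|b / (b - a)| * Kb) _ _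
  (fun n => Tn_distinct n M0 aM bM abM ab)).
  apply: geo_ext (geoD (geoZ (a / (a - b)) ga) (geoZ (b / (b - a)) gb)) => n.
  rewrite (ccoef_poles q z n ab).
  move: (polesum _ _ _) (polesum _ _ _) (polepart _ _ _ _ _ _ _).
  move: (polepart _ _ _ _ _ _ _) => X Y Z T; ring.
move=> n; apply: (@le_trans _ _ (`|a / (a - b)| * Ka + `|b / (b - a)| * Kb)).
  exact: norm_lincomb_le (hKa n) (hKb n).
by apply: ler_peMr; [apply: addr_ge0; apply: mulr_ge0 | rewrite ler1n].
Qed.

End Asymptotics.

Section Equal.
Variable R : realType.
Local Notation C := (Cplx R).
Variables (q a z : C).
Hypotheses (q0 : q != 0) (q1 : `|q| < 1) (a0 : a != 0) (z0 : z != 0).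
Hypotheses (n1 : qpochinf (z / a) q != 0) (n2 : qpochinf (1 / (a * z)) q != 0).
Local Notation c := (ccoef q a a z).
Local Notation h := (hcoef q a a z).
Implicit Types n : nat.

Lemma ccoef_double n : c n =
  \sum_(k < n.+1) h k * ((n - k).+1%:R * a ^+ (n - k)).
Proof.
rewrite (@quadmul_inv _ (a + a) (a * a) c (fun m => m.+1%:R * a ^+ m)) //.
- by rewrite expr0 mulr1.
- by rewrite expr1; ring.
- by move=> m; rewrite !exprS -[m.+3%:R]natr1 -[m.+2%:R]natr1; ring.
Qed.

Lemma Tn_geo_equal :
  geo (fun n => ((-1) ^+ n * qpoch q q n * c n - Tn z a a q n) / `|a| ^+ n).
Proof.
have M0 : 0 < `|a| by rewrite normr_gt0.
have ph : pconv h a^-1.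
  apply: (pconv_hcoef (M := `|a|)) => //.
  by rewrite normrM normfV mulfVK // gt_eqF.
have g := pole_double M0 (erefl _) ph.
set H := psum h a^-1 in g; set H' := psum _ a^-1 in g.
apply: (@geo_main _ q z q0 q1 a a `|a|
  (fun n => a ^+ n * (n.+1%:R * H - a^-1 * H')) _ (`|H| + `|a^-1 * H'|) M0).
- by apply: geo_ext g => n; rewrite ccoef_double.
- move=> n; rewrite mulrAC normrM.
  apply: le_trans (ler_piMl _ (normX_div_le n (lexx _) M0)) _ => //.
  apply: le_trans (ler_normB _ _) _; rewrite normrM normr_nat mulrDl mulrC lerD2l.
  by apply: ler_peMr => //; rewrite ler1n.
move=> n; rewrite /Tn ltxx eqxx /=.
have e := psum_hcoef_inv q0 q1 a0 a0 z0 M0 (lexx _) (lexx _) (erefl _).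
have eq : a * q / a = q by field.
rewrite eq in e.
have nq : qexp q (- q) != 0 by apply: qexp_neq0.
have -> : a ^+ n * (n.+1%:R * H - a^-1 * H') = a ^+ n * ((n%:R + 1 + lambda z a q) * H).
  rewrite [(_ + lambda _ _ _) * _]mulrDl natr1; congr (_ * (_ + _)).
  by rewrite (lambdaE q0 q1 z0 M0 (erefl _) n1 n2).
rewrite !(qpochinfE _ q0 q1) -e -/H (exprNn a).
move: (qexp q (- q)) nq (lambda z a q) => E nE L.
by field.
Qed.

End Equal.

(** * The asymptotic formula *)

Section Final.
Variable R : realType.
Local Notation C := (Cplx R).
Implicit Types (q a b z M : C) (n : nat).

Lemma near_natr_ge (x : C) : \forall n \near \oo, `|x| <= n%:R.
Proof.
have [N xN] := natr_gt (normr_ge0 x); near=> n.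
have Nn : (N <= n)%N by near: n; exact: nbhs_infty_ge.
by rewrite (le_trans (ltW xN)) // ler_nat.
Unshelve. all: by end_near. Qed.

Lemma Tn_geo q a b z : q != 0 -> `|q| < 1 -> a != 0 -> b != 0 -> z != 0 ->
  (a = b -> qpochinf (z / a) q != 0 /\ qpochinf (1 / (a * z)) q != 0) ->
  geo (fun n => ((-1) ^+ n * qpoch q q n * ccoef q a b z n - Tn z a b q n)
     / Num.max `|a| `|b| ^+ n).
Proof.
move=> q0 q1 a0 b0 z0 lam.
have na : 0 < `|a| by rewrite normr_gt0.
have nb : 0 < `|b| by rewrite normr_gt0.
have [ab|ab] := eqVneq a b.
  have [n1 n2] := lam ab; rewrite -ab.
  by rewrite /Order.max ltxx; exact: Tn_geo_equal.
rewrite /Order.max; have [lt_ab|lt_ba|e_ab] := real_ltgtP (normr_real a) (normr_real b).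
- by apply: Tn_geo_distinct => //; [exact: ltW | right].
- by apply: Tn_geo_distinct => //; [exact: ltW | left].
- by apply: Tn_geo_distinct => //; [rewrite e_ab | left].
Qed.

Lemma max_normr_gt0 a b : a != 0 -> 0 < Num.max `|a| `|b|.
Proof.
move=> a0; have na : 0 < `|a| by rewrite normr_gt0.
by rewrite /Order.max; case: ifP => // /(lt_trans na).
Qed.

(** In these cases T_n is a nonzero constant times w^n with |w| = M or, if a = b,
    also times n + 1 + lambda, whose modulus is at least 1 once n >= |lambda|. *)
Lemma Tn_lower q a b z : q != 0 -> `|q| < 1 -> a != 0 -> b != 0 ->
  (a = b -> qpochinf (z / a) q != 0 /\ qpochinf (1 / (a * z)) q != 0) ->
  (`|a| < `|b| -> qpochinf (z / b) q * qpochinf (1 / (b * z)) q != 0) ->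
  (`|b| < `|a| -> qpochinf (z / a) q * qpochinf (1 / (a * z)) q != 0) ->
  (`|a| = `|b| -> a = b) ->
  exists2 k : C, 0 < k &
    \forall n \near \oo, k * Num.max `|a| `|b| ^+ n <= `|Tn z a b q n|.
Proof.
move=> q0 q1 a0 b0 lam hab hba e_ab.
have lead_norm a' b' n : `|lead z a' b' q n| = `|qpochinf (z / a') q
   * qpochinf (1 / (a' * z)) q / qpochinf (b' / a') q| * `|a'| ^+ n.
  by rewrite /lead -mulrA normrM normrX normrN mulrC.
have nz (a' b' : C) : a' != 0 -> `|b'| < `|a'| -> qpochinf (b' / a') q != 0.
  move=> a'0 ba; rewrite (qpochinfE _ q0 q1); apply: qexp_neq0 => //.
  by rewrite normrM normfV ltr_pdivrMr ?normr_gt0 // mul1r.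
rewrite /Tn /Order.max.
have [lt_ab|lt_ba|e] := real_ltgtP (normr_real a) (normr_real b).
- exists (`|qpochinf (z / b) q * qpochinf (1 / (b * z)) q / qpochinf (a / b) q|).
    by rewrite normr_gt0 mulf_neq0 ?hab // invr_neq0 // nz.
  by near=> n; rewrite lead_norm.
- exists (`|qpochinf (z / a) q * qpochinf (1 / (a * z)) q / qpochinf (b / a) q|).
    by rewrite normr_gt0 mulf_neq0 ?hba // invr_neq0 // nz.
  by near=> n; rewrite lead_norm.
have ab := e_ab e; subst b; have [n1 n2] := lam erefl; rewrite eqxx /=.
have nqq : qpochinf q q != 0 by rewrite (qpochinfE _ q0 q1); apply: qexp_neq0.
set k := qpochinf (z / a) q * qpochinf (1 / (a * z)) q / qpochinf q q.
have k0 : 0 < `|k|.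
  by rewrite normr_gt0; exact: mulf_neq0 (mulf_neq0 n1 n2) (invr_neq0 nqq).
exists `|k| => //; near=> n.
have nl : `|lambda z a q| <= n%:R by near: n; exact: near_natr_ge.
have TE (X Y A B D : C) : X * Y * (A * B) / D = X * Y * (A * B / D) by ring.
rewrite TE -/k !normrM normrX normrN mulrC.
apply: ler_wpM2r => //; apply: ler_peMl; first by rewrite exprn_ge0.
have h := lerB_dist (n%:R + 1) (- lambda z a q); rewrite opprK normrN in h.
apply: le_trans h; rewrite natr1 normr_nat -natr1 addrAC lerDr subr_ge0.
exact: nl.
Unshelve. all: by end_near. Qed.

End Final.

Theorem lemma4p17 (R : realType) (q a b z x : Cplx R)
    (q_gt0 : 0 < `|q|) (q_lt1 : `|q| < 1)
    (a_neq0 : a != 0) (b_neq0 : b != 0) (z_neq0 : z != 0)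
    (xE : x = (z + z^-1) / 2)
    (lambda_def : a = b ->
       qpochinf (z / a) q != 0 /\ qpochinf (1 / (a * z)) q != 0) :
  let Q := fun n => ASC n x a b q^-1 in
  let main := fun n => q ^- 'C(n, 2) * Tn z a b q n in
  let err := fun n =>
    `|q| ^- 'C(n, 2) * Num.max `|a| `|b| ^+ n / n%:R in
  [/\ (fun n => Q n - main n) =O_\oo err,
      ((`|a| < `|b| ->
          qpochinf (z / b) q * qpochinf (1 / (b * z)) q != 0) ->
       (`|b| < `|a| ->
          qpochinf (z / a) q * qpochinf (1 / (a * z)) q != 0) ->
       (`|a| = `|b| -> a != b -> err =o_\oo main) ->
       Q ~_\oo main) &
      forall t : Cplx R,
        (fun n => \sum_(1 <= k < n)
           q ^+ 'C(k, 2) / qpoch q q k * k%:R * t ^+ k.-1)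
        @ \oo --> qexp' q t].
Proof.
move=> Q main err.
have q0 : q != 0 by rewrite -normr_gt0.
pose M := Num.max `|a| `|b|.
have M0 : 0 < M := max_normr_gt0 b a_neq0.
have QE n : Q n - main n = q ^- 'C(n, 2) *
    ((-1) ^+ n * qpoch q q n * ccoef q a b z n - Tn z a b q n).
  have h1 m : 1 - q ^+ m.+1 != 0 by exact: subr1X_neq0.
  rewrite /Q /main xE (ASC_zE n a b q^-1 z_neq0).
  by rewrite (ASC_ccoef q0 a_neq0 b_neq0 z_neq0 h1 n); ring.
have QO : (fun n => Q n - main n) =O_\oo err.
  have [K K0 hK] := geo_bounded (geo_muln
    (Tn_geo q0 q_lt1 a_neq0 b_neq0 z_neq0 lambda_def)).
  (* At n = 0 the error term is x / 0 = 0, so the estimate starts at n = 1. *)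
  apply/eqO_exP; exists K => //; near=> n.
  have n0 : (0 < n)%N by near: n; exact: nbhs_infty_gt.
  have nr : 0 < n%:R :> Cplx R by rewrite ltr0n.
  have Mn : 0 < M ^+ n by rewrite exprn_gt0.
  rewrite QE normrM normfV normrX /err -/M.
  have -> : `| `|q| ^- 'C(n, 2) * M ^+ n / n%:R| = `|q| ^- 'C(n, 2) * (M ^+ n / n%:R).
    rewrite !normrM !normfV !normrX normr_id normr_nat (gtr0_norm M0) mulrA //.
  rewrite mulrCA; apply: ler_wpM2l; first by rewrite invr_ge0 exprn_ge0.
  have := hK n; rewrite -/M normrM normr_nat normrM normfV (gtr0_norm Mn).
  by rewrite mulrA ler_pdivrMr // mulrC -ler_pdivlMr // mulrA.
split => //; last by move=> t; apply: qexp'_series.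
move=> hab hba hoab.
have eo : err =o_\oo main.
  have [[e ne]|ne] := pselect (`|a| = `|b| /\ a != b).
    exact: hoab.
  have e_ab : `|a| = `|b| -> a = b.
    by move=> e; apply/eqP/negPn/negP => nab; apply: ne; split.
  have [k k0 hk] := Tn_lower q0 q_lt1 a_neq0 b_neq0 lambda_def hab hba e_ab.
  apply/eqoP => e e0; near=> n.
  have hkn : k * M ^+ n <= `|Tn z a b q n| by near: n; exact: hk.
  have n0 : (0 < n)%N by near: n; exact: nbhs_infty_gt.
  have nr : 0 < n%:R :> Cplx R by rewrite ltr0n.
  have hn : `|(e * k)^-1| <= n%:R by near: n; exact: near_natr_ge.
  have ek : 0 < e * k by rewrite mulr_gt0.
  have Mn : 0 < M ^+ n by rewrite exprn_gt0.
  rewrite gtr0_norm ?invr_gt0 // in hn.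
  rewrite /err /main -/M !normrM !normfV !normrX normr_id normr_nat (gtr0_norm M0).
  rewrite mulrCA -mulrA; apply: ler_wpM2l; first by rewrite invr_ge0 exprn_ge0.
  apply: le_trans (ler_wpM2l (ltW e0) hkn); rewrite mulrA mulrC ler_wpM2r //.
    exact: ltW.
  by rewrite -[leRHS]invrK lef_pV2 // posrE ?invr_gt0.
apply/eqaddoP; apply/eqoP.
exact: eqOo_trans QO eo.
Unshelve. all: by end_near. Qed.
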